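(* Let $F=Z+W\mathbf j\in L^1(\mathbb T^d;\mathbb H^{s\times s})$ ($Z,W$ $\mathbb C_{\mathbf i}^{s\times s}$-valued), fix $\tau\in\{L,R,(S_L,S_R)\}$, and assume $T^{(\tau)}_{\boldsymbol n}(F)$ is Hermitian for all $\boldsymbol n\in\mathbb N^d$. Set $m_\tau=\operatorname{ess\,inf}_{\boldsymbol\theta\in\mathbb T^d}\lambda_{\min}(G_\tau(\boldsymbol\theta))$ and $M_\tau=\operatorname{ess\,sup}_{\boldsymbol\theta\in\mathbb T^d}\lambda_{\max}(G_\tau(\boldsymbol\theta))$. Then for every $\boldsymbol n\in\mathbb N^d$, all eigenvalues of $T^{(\tau)}_{\boldsymbol n}(F)$ lie in $[m_\tau,M_\tau]$.
   Context: $\mathbb H$ is the quaternion algebra with units $\mathbf i,\mathbf j,\mathbf k=\mathbf i\mathbf j$; $\mathbb C_{\mathbf i}=\operatorname{span}_{\mathbb R}\{1,\mathbf i\}\cong\mathbb C$. Eigenvalues of a quaternion matrix are right eigenvalues ($Ax=x\lambda$); for a Hermitian quaternion matrix they are real. $\mathbb T^d=[-\pi,\pi)^d$; $S_L\dot\cup S_R=\{1,\dots,d\}$ ordered partition; $\tau=L$ means $S_L=\{1,\dots,d\}$, $\tau=R$ means $S_R=\{1,\dots,d\}$. Sandwich Fourier coefficients $\widehat F^{(S_L,S_R)}(\boldsymbol k)=(2\pi)^{-d}\int e^{-\mathbf i\langle\boldsymbol k,\boldsymbol\theta\rangle_{S_L}}F(\boldsymbol\theta)e^{-\mathbf i\langle\boldsymbol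 k,\boldsymbol\theta\rangle_{S_R}}d\boldsymbol\theta$, $\langle\boldsymbol k,\boldsymbol\theta\rangle_S=\sum_{j\in S}k_j\theta_j$; $T^{(\tau)}_{\boldsymbol n}(F)=[\widehat F^{(\tau)}(\alpha-\beta)]_{\alpha,\beta\in\Lambda_{\boldsymbol n}}$, $\Lambda_{\boldsymbol n}=\prod_\ell\{0,\dots,n_\ell-1\}$ (lexicographic). With $r_{S_L}(\boldsymbol\theta)_j=-\theta_j$ for $j\in S_L$ and $\theta_j$ for $j\in S_R$, $G_{(S_L,S_R)}(\boldsymbol\theta)=\begin{pmatrix}Z(\boldsymbol\theta)&W(r_{S_L}(-\boldsymbol\theta))\\-\overline{W(r_{S_L}(\boldsymbol\theta))}&\overline{Z(-\boldsymbol\theta)}\end{pmatrix}\in\mathbb C^{2s\times2s}$ (bar = complex conjugation). *)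

(* Defs.v *)
From HB Require Import structures.
From mathcomp Require Import all_boot all_order all_algebra.
From mathcomp Require Import all_classical all_reals all_analysis.
From mathcomp Require Import ess_sup_inf.
From mathcomp.real_closed Require Import complex.
From mathcomp Require Import lra.
Set Implicit Arguments. Unset Strict Implicit. Unset Printing Implicit Defensive.
Import Order.TTheory GRing.Theory Num.Theory.
Local Open Scope classical_set_scope.
Local Open Scope ring_scope.

Section Torus.
Variable R : realType.

Lemma Npi_lt_pi : - (pi : R) < pi.
Proof. have := pi_gt0 R; lra. Qed.

Definition RL : measurableType _ :=
  g_sigma_algebraType (R.-ocitv.-measurable).

Definition cons_tup (n : nat) (p : RL * n.-tuple RL) : n.+1.-tuple RL :=
  [tuple of p.1 :: p.2].

Lemma measurable_cons_tup n : measurable_fun setT (@cons_tup n).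
Proof. exact: measurable_cons. Qed.

HB.instance Definition _ n := isMeasurableFun.Build _ _ _ _ (@cons_tup n)
  (@measurable_cons_tup n).

Definition unifT : probability RL R := uniform_prob Npi_lt_pi.

Fixpoint torus_prob (n : nat) : probability (n.-tuple RL) R :=
  match n with
  | 0 => dirac [tuple] : probability _ R
  | n.+1 => distribution (unifT \x torus_prob n)%E (@cons_tup n) : probability _ R
  end.
End Torus.

Arguments RL : clear implicits.
Arguments torus_prob : clear implicits.

Section Quat.
Variable R : realType.
Local Open Scope complex_scope.

(** quaternions q = z + w j, z w in C_i *)
Definition quat := (R[i] * R[i])%type.
Definition qC (z : R[i]) : quat := (z, 0%R).
(* (z1 + w1 j)(z2 + w2 j) = (z1 z2 - w1 conj w2) + (z1 w2 + w1 conj z2) j *)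
Definition qmul (p q : quat) : quat :=
  (p.1 * q.1 - p.2 * q.2^*, p.1 * q.2 + p.2 * q.1^*)%R.
Definition qconj (q : quat) : quat := (q.1^*, - q.2)%R.
Definition expi (t : R) : R[i] := cos t +i* sin t.


Variable d : nat.
Notation Tor := (d.-tuple (RL R)).
Notation P := (torus_prob R d).

(* real integral against the normalized measure (2 pi)^-d d theta on [-pi,pi]^d *)
Definition cint (g : Tor -> R[i]) : R[i] :=
  Rintegral P setT (fun t => complex.Re (g t)) +i* Rintegral P setT (fun t => complex.Im (g t)).
Definition qint (f : Tor -> quat) : quat :=
  (cint (fun t => (f t).1), cint (fun t => (f t).2)).

(* <k, theta>_S *)
Definition dotS (S : {set 'I_d}) (k : 'I_d -> int) (t : Tor) : R :=
  (\sum_(j < d | j \in S) (k j)%:~R * (tnth t j : R))%R.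

Variable s : nat.
Variables (Z W : Tor -> 'M[R[i]]_s).

Definition Fq (t : Tor) (p q : 'I_s) : quat := (Z t p q, W t p q).

(* sandwich Fourier coefficient, entry (p,q), for tau = (S_L, S_R = ~: S_L) *)
Definition fhat (SL : {set 'I_d}) (k : 'I_d -> int) (p q : 'I_s) : quat :=
  qint (fun t => qmul (qmul (qC (expi (- dotS SL k t))) (Fq t p q))
                      (qC (expi (- dotS (~: SL) k t)))).

Definition Lam (n : 'I_d -> nat) := {dffun forall l : 'I_d, 'I_(n l)}.

(* T_n^(tau)(F), indexed by Lambda_n x {0..s-1} (block layout) *)
Definition toep (SL : {set 'I_d}) (n : 'I_d -> nat)
    (a b : (Lam n * 'I_s)%type) : quat :=
  fhat SL (fun l => (a.1 l : nat)%:Z - (b.1 l : nat)%:Z) a.2 b.2.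

Definition negT (t : Tor) : Tor := [tuple (- (tnth t j : R) : RL R) | j < d].
Definition rS (SL : {set 'I_d}) (t : Tor) : Tor :=
  [tuple (if j \in SL then - (tnth t j : R) else (tnth t j : R) : RL R) | j < d].

Definition Gmat (SL : {set 'I_d}) (t : Tor) : 'M[R[i]]_(s + s) :=
  block_mx (Z t) (W (rS SL (negT t)))
           (- map_mx (@conjc R) (W (rS SL t))) (map_mx (@conjc R) (Z (negT t))).

Definition L1 : Prop := forall p q : 'I_s,
  [/\ P.-integrable setT (fun t => (complex.Re (Z t p q))%:E),
      P.-integrable setT (fun t => (complex.Im (Z t p q))%:E),
      P.-integrable setT (fun t => (complex.Re (W t p q))%:E) &
      P.-integrable setT (fun t => (complex.Im (W t p q))%:E)].
End Quat.

Arguments toep {R d s} Z W SL n a b.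

Section Eig.
Variable R : realType.
(* Hermitian quaternion matrix (indexed by a finite type) *)
Definition qherm (I : finType) (A : I -> I -> quat R) : Prop :=
  forall a b, A b a = qconj (A a b).
(* right eigenvalue: A x = x lam, x <> 0 *)
Definition qeig (I : finType) (A : I -> I -> quat R) (lam : quat R) : Prop :=
  exists x : I -> quat R, (exists i, x i != 0%R) /\
    (forall a, (\sum_b qmul (A a b) (x b))%R = qmul (x a) lam).

Definition lam_min n (G : 'M[R[i]]_n) : R := inf [set r : R | eigenvalue G (r%:C)%C].
Definition lam_max n (G : 'M[R[i]]_n) : R := sup [set r : R | eigenvalue G (r%:C)%C].
End Eig.


Section EssBounds.
Variables (R : realType) (d s : nat) (Z W : d.-tuple (RL R) -> 'M[R[i]]_s).
Variable SL : {set 'I_d}.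
(* m_tau = ess inf lambda_min (G_tau), M_tau = ess sup lambda_max (G_tau) *)
Definition m_tau : \bar R :=
  ess_inf (torus_prob R d) (fun t => (lam_min (Gmat Z W SL t))%:E).
Definition M_tau : \bar R :=
  ess_sup (torus_prob R d) (fun t => (lam_max (Gmat Z W SL t))%:E).
End EssBounds.

(* Main.v *)
Require Import Defs.
From HB Require Import structures.
From mathcomp Require Import all_boot all_order all_algebra.
From mathcomp Require Import all_classical all_reals all_analysis.
From mathcomp Require Import ess_sup_inf measurable_realfun.
From mathcomp Require Import spectral sesquilinear.
From mathcomp.real_closed Require Import complex.
From mathcomp Require Import zify ring lra.
Set Implicit Arguments. Unset Strict Implicit. Unset Printing Implicit
  Defensive.
Import Order.TTheory GRing.Theory Num.Theory.
Import numFieldNormedType.Exports.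
Local Open Scope classical_set_scope.
Local Open Scope ring_scope.

(** If [T x = x r] with [x = x1 + x2 j], the complex vector [y = (x1, - conj x2)]
    satisfies [T_n(G) y = r y], where [T_n(G)] is the complex Toeplitz matrix of the
    [2s x 2s] symbol [G]: the reflections of the torus in the definition of [G]
    absorb the conjugations coming from moving [j] across the exponentials.
    With the trigonometric polynomial [v(t) = \sum_a e^(i<a,t>) y_a] one gets
    [r |y|^2 = \int v^* G v] and [|y|^2 = \int |v|^2], so the Rayleigh bounds for
    [G(t)] give the claim as soon as [G] is Hermitian almost everywhere.

    The latter follows from the symmetry of the Fourier coefficients by the
    uniqueness theorem for [L^1] functions on the torus.  To prove it, let [f] have
    vanishing coefficients and consider the bounded [h] with [\int f h c = 0] for all
    [c(t) = cos(<k,t> + phi)].  This class is linear, closed under bounded pointwise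
    limits and under multiplication by [cos(t_j + psi)].  The measurable sets whose
    indicator multiplies the class into itself form a sigma-algebra; it contains the
    sets [cos(t_j + psi) < a], hence all measurable sets, and so [f = 0] a.e. *)

(** * Cutoff polynomials and annihilators *)

Section cutoff.
Variable R : realType.
Implicit Type u : R.

(** The powers of [v] decrease, so [n v^n] is at most the geometric sum [1 + v + ... + v^(n-1)],
    which is [(1 - v^n) / (1 - v)]. *)
Lemma natr_mulX_le (v : R) n : 0 <= v < 1 -> n%:R * v ^+ n <= (1 - v)^-1.
Proof.
move=> /andP[v0 v1]; rewrite -[leRHS]mul1r ler_pdivlMr ?subr_gt0//.
suff : n%:R * v ^+ n * (1 - v) <= 1 - v ^+ n.
  by move=> /le_trans; apply; rewrite gerBl exprn_ge0.
elim: n => [|n IH]; first by rewrite !mul0r expr0 subrr.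
have vn : 0 <= v ^+ n by exact: exprn_ge0.
have n0 : (0 : R) <= n%:R by [].
rewrite exprS -natr1; move: IH vn n0.
move: (v ^+ n) (n%:R) => w m IH w0 m0.
have vIH := ler_wpM2l v0 IH.
have v1' : 0 <= 1 - v by lra.
have w1 : w <= 1 by have := mulr_ge0 (mulr_ge0 m0 w0) v1'; lra.
have vw1 : v * w <= 1 by rewrite mulr_ile1// ltW.
have := ler_wpM2r v1' vw1; nra.
Qed.

Lemma cvg_natr_mulX u : 0 <= u < 1 -> (n%:R * u ^+ n) @[n --> \oo] --> (0 : R).
Proof.
(* With [u = v^2], the sequence is [(n v^n) v^n]: a bounded factor times one that tends to 0. *)
move=> /andP[u0 u1]; pose v := Num.sqrt u.
have v0 : 0 <= v by exact: sqrtr_ge0.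
have v1 : v < 1 by rewrite -sqrtr1 ltr_sqrt.
have uE : u = v * v by rewrite -expr2 sqr_sqrtr.
apply: (@squeeze_cvgr _ _ _ _ (cst 0) (fun n => (1 - v)^-1 * v ^+ n)).
- near=> n; rewrite mulr_ge0 ?exprn_ge0//= uE exprMn mulrA.
  by rewrite ler_wpM2r ?exprn_ge0// natr_mulX_le// v0.
- exact: cvg_cst.
- rewrite -[X in _ --> X](mulr0 (1 - v)^-1); apply: cvgM; first exact: cvg_cst.
  by apply: cvg_expr; rewrite ger0_norm.
Unshelve. all: by end_near. Qed.

(** The induction step is [(1 - u)(1 + (n + 1) u) = 1 + n u - (n + 1) u^2]. This is the upper
    estimate for the cutoff; Bernoulli's inequality below is the lower one. *)
Lemma mul_exprB1_le1 u n : 0 <= u <= 1 -> (1 - u) ^+ n * (1 + n%:R * u) <= 1.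
Proof.
move=> /andP[u0 u1]; elim: n => [|n IH];
  first by rewrite expr0 mul0r addr0 mulr1.
have p0 : 0 <= (1 - u) ^+ n by rewrite exprn_ge0// subr_ge0.
have n0 : (0 : R) <= n%:R by [].
apply: le_trans IH; rewrite exprSr -mulrA ler_wpM2l// -natr1.
by move: (n%:R) n0 => m m0; nra.
Qed.

Lemma bernoulli_exprB1 u n : 0 <= u <= 1 -> 1 - n%:R * u <= (1 - u) ^+ n.
Proof.
move=> /andP[u0 u1]; elim: n => [|n IH]; first by rewrite expr0 mul0r subr0.
have n0 : (0 : R) <= n%:R by [].
have u1' : 0 <= 1 - u by rewrite subr_ge0.
rewrite exprSr; apply: le_trans (ler_wpM2r u1' IH); rewrite -natr1.
by move: (n%:R) n0 => m m0; nra.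
Qed.

(* The factor [n] in the exponent makes the limit [0] at the threshold [1/2]. *)
Lemma cvg_cutoff u : 0 <= u <= 1 ->
  ((1 - u ^+ n) ^+ (n * 2 ^ n)%N) @[n --> \oo] --> ((u < 2^-1)%R%:R : R).
Proof.
move=> /andP[u0 u1].
have un n : 0 <= u ^+ n <= 1 by rewrite exprn_ge0//= exprn_ile1.
have NE n : (n * 2 ^ n)%N%:R * u ^+ n = n%:R * (2 * u) ^+ n.
  by rewrite natrM natrX -mulrA -exprMn.
have [u2|u2] := ltP u 2^-1.
  (* Below the threshold [2 u < 1], so the error [n (2 u)^n] in Bernoulli's inequality vanishes in
     the limit. *)
  apply: (@squeeze_cvgr _ _ _ _ (fun n => 1 - n%:R * (2 * u) ^+ n) (cst 1)).
  - near=> n; rewrite -NE bernoulli_exprB1//= exprn_ile1//.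
      by have := un n; rewrite subr_ge0 => /andP[].
    by have := un n; rewrite gerBl => /andP[].
  - rewrite -[X in _ --> X]subr0; apply: cvgB; first exact: cvg_cst.
    by apply: cvg_natr_mulX; apply/andP; split; lra.
  - exact: cvg_cst.
(* From the threshold on, [(2 u)^n >= 1], so the exponent times [u^n] is at least [n] and the power
   is at most [1 / (n + 1)]. *)
apply: (@squeeze_cvgr _ _ _ _ (cst 0) (@harmonic R)).
- near=> n; have /andP[un0 un1] := un n.
  have p0 : 0 <= (1 - u ^+ n) ^+ (n * 2 ^ n)%N by rewrite exprn_ge0// subr_ge0.
  rewrite p0/= -[leRHS]mul1r ler_pdivlMr//.
  apply: le_trans (mul_exprB1_le1 (n * 2 ^ n)%N (un n)); rewrite ler_wpM2l//.
  rewrite NE -natr1 addrC lerD2l -[leLHS]mulr1 ler_wpM2l// exprn_ege1//; lra.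
- exact: cvg_cst.
- exact: cvg_harmonic.
Unshelve. all: by end_near. Qed.
End cutoff.

(** * Bounded functions [h] for which [f h] is orthogonal to a class of test functions *)

Section annihilator.
Context d (T : measurableType d) (R : realType)
  (mu : {measure set T -> \bar R}).

Lemma integrable_mul_bounded (f h : T -> R) B :
  mu.-integrable setT (EFin \o f) -> measurable_fun setT h ->
  (forall x, `|h x| <= B) ->
  mu.-integrable setT (EFin \o (fun x => f x * h x)).
Proof.
move=> fi mh hB.
apply: (@le_integrable _ _ _ _ _ measurableT _
  (fun x => B%:E * (EFin \o f) x)%E).
- by apply/measurable_EFinP; apply: measurable_funM => //;
    apply/measurable_EFinP; exact: measurable_int fi.
- move=> x _ /=; rewrite lee_fin !normrM mulrC ler_wpM2r//.
  by rewrite (le_trans (hB x))// ler_norm.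
- exact: integrableZl.
Qed.

Variable f : T -> R.
Hypothesis fi : mu.-integrable setT (EFin \o f).
Variable C : set (T -> R).
Hypothesis Cm : forall c, C c -> measurable_fun setT c.
Hypothesis Cb : forall c, C c -> forall x, `|c x| <= 1.

(** Boundedness of [h] keeps [f h c] integrable for a merely integrable [f]. *)
Definition annih (h : T -> R) : Prop :=
  [/\ measurable_fun setT h, (exists B, forall x, `|h x| <= B) &
      forall c, C c -> Rintegral mu setT (fun x => f x * h x * c x) = 0].

Lemma annih_integrable h c : annih h -> C c ->
  mu.-integrable setT (EFin \o (fun x => f x * h x * c x)).
Proof.
move=> [mh [B hB] _] Cc.
apply: (@integrable_mul_bounded (fun x => f x * h x) c 1) => //.
- exact: integrable_mul_bounded hB.
- exact: Cm.
- exact: Cb.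
Qed.

Lemma annih_lin a b h1 h2 : annih h1 -> annih h2 ->
  annih (fun x => a * h1 x + b * h2 x).
Proof.
move=> h1a h2a; have [m1 [B1 hB1] i1] := h1a; have [m2 [B2 hB2] i2] := h2a.
split.
- by apply: measurable_funD; apply: measurable_funM.
- exists (`|a| * B1 + `|b| * B2) => x.
  by rewrite (le_trans (ler_normD _ _))// !normrM lerD// ler_wpM2l.
- move=> c Cc.
  under eq_Rintegral.
    move=> x _; rewrite (_ : _ * _ =
      a * (f x * h1 x * c x) + b * (f x * h2 x * c x)); last by ring.
    over.
  have j1 := annih_integrable h1a Cc; have j2 := annih_integrable h2a Cc.
  rewrite RintegralD//; [|exact: (integrableZl _ _ j1)|exact: (integrableZl _ _
    j2)].
  by rewrite !RintegralZl// i1// i2// !mulr0 addr0.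
Qed.

(** Dominated convergence with dominating function [B |f|], as test functions are bounded by 1. *)
Lemma annih_lim (h_ : nat -> T -> R) (h : T -> R) (B : R) :
  (forall n, annih (h_ n)) ->
  (forall n x, `|h_ n x| <= B) ->
  (forall x, h_ ^~ x @ \oo --> h x) -> annih h.
Proof.
move=> ah hB hlim.
have mh : measurable_fun setT h.
  by apply: (measurable_fun_cvg (h := h_)) => // n; case: (ah n).
split => //.
  exists B => x.
  have nx : `|h_ n x| @[n --> \oo] --> `|h x| by exact: cvg_norm (hlim x).
  rewrite -(cvg_lim _ nx)//; apply: limr_le; first exact: cvgP nx.
  by near=> n; exact: hB.
move=> c Cc.
have mf : measurable_fun setT f.
  by apply/measurable_EFinP; exact: measurable_int fi.
have [] := @dominated_convergence _ _ _ mu setT measurableT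
  (fun n x => (f x * h_ n x * c x)%:E) (fun x => (f x * h x * c x)%:E)
  (fun x => (B%:E * `|(f x)%:E|)%E).
- by move=> n; apply/measurable_EFinP/measurable_funM;
    [apply: measurable_funM => //; case: (ah n)|exact: Cm].
- by apply/measurable_EFinP/measurable_funM;
    [apply: measurable_funM|exact: Cm].
- apply: aeW => x _; apply: cvg_EFin; first by near=> n.
  by apply: cvgM; [apply: cvgM => //|]; exact: cvg_cst.
- by apply: integrableZl => //; exact: integrable_abse.
- apply: aeW => x n _; rewrite /= lee_fin !normrM.
  rewrite -[leRHS]mulr1 ler_pM//; [|exact: Cb].
  by rewrite mulrC ler_pM.
- move=> _ _ lim0; rewrite /Rintegral.
  suff -> : (\int[mu]_x (f x * h x * c x)%:E = 0)%E by [].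
  apply: cvg_unique lim0 _ => //; apply: cvg_near_cst.
  near=> n; rewrite -[LHS]fineK.
    by have [_ _ /(_ _ Cc) i0] := ah n; congr EFin.
  exact: (integrable_fin_num measurableT (annih_integrable (ah n) Cc)).
Unshelve. all: by end_near. Qed.

Lemma annih_ae0 (h : T -> R) : measurable_fun setT h ->
  (exists B, forall x, `|h x| <= B) ->
  {ae mu, forall x, h x = 0} -> annih h.
Proof.
move=> mh hB h0; split => // c Cc; rewrite /Rintegral.
have mf : measurable_fun setT f.
  by apply/measurable_EFinP; exact: measurable_int fi.
rewrite (@ae_eq_integral _ _ _ mu setT (cst 0%E))//; first by rewrite integral0.
- by apply/measurable_EFinP/measurable_funM; [exact: measurable_funM|exact: Cm].
- by apply: filterS h0 => x /= -> _; rewrite mulr0 mul0r.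
Qed.

(** Asking that [\1_E] multiply the class into itself, rather than belong to it, makes closure under
    intersection a mere composition, so no monotone class argument is required. *)
Definition annih_stable (E : set T) : Prop :=
  measurable E /\ forall h, annih h -> annih (fun x => \1_E x * h x).

Definition annih_mul (g : T -> R) : Prop :=
  forall h, annih h -> annih (fun x => g x * h x).

Lemma annih_mulX g n : annih_mul g -> annih_mul (fun x => g x ^+ n).
Proof.
move=> mg; elim: n => [|n IH] h ah.
  by under [X in annih X]funext do rewrite expr0 mul1r.
by under [X in annih X]funext do rewrite exprS -mulrA; exact/mg/IH.
Qed.

Lemma annih_mul_lin a b g : annih_mul g -> annih_mul (fun x => a + b * g x).
Proof.
move=> mg h ah; have := annih_lin a b ah (mg _ ah).
by congr annih; apply/funext => x; ring.
Qed.

(* [g < t] iff [u < 1/2] for [u = 1/2 + (g - t)/4], whose values lie in [0, 1]. *)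
Lemma annih_stable_lt g t : measurable_fun setT g -> annih_mul g ->
  (forall x, -1 <= g x <= 1) -> -1 <= t <= 1 ->
  annih_stable [set x | g x < t].
Proof.
move=> mg ag g1 t1; split.
  by rewrite -[X in measurable X]setTI; exact: measurable_fun_ltr.
move=> h ah; have [_ [B hB] _] := ah.
pose u x := (2^-1 - t / 4) + 4^-1 * g x.
have u01 x : 0 <= u x <= 1 by have := g1 x; move: t1; rewrite /u; lra.
(* A polynomial in [g] times [h], hence in the class; [cvg_cutoff] gives its pointwise limit
   [\1_(u < 1/2) h]. *)
pose p n x := (1 + (-1) * u x ^+ n) ^+ (n * 2 ^ n)%N * h x.
apply: (@annih_lim p _ B).
- move=> n; apply: (annih_mulX (n * 2 ^ n)%N _ ah).
  by apply: annih_mul_lin; apply: annih_mulX; apply: annih_mul_lin.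
- move=> n x; rewrite /p normrM -[leRHS]mul1r ler_pM//.
  rewrite normrX exprn_ile1// mulN1r.
  by rewrite ger0_norm ?subr_ge0 ?exprn_ile1 ?gerBl ?exprn_ge0//;
    have /andP[] := u01 x.
- move=> x; rewrite /p; apply: cvgM; last exact: cvg_cst.
  rewrite indicE.
  rewrite (_ : (x \in _) = (u x < 2^-1)); last first.
    by apply/idP/idP; rewrite inE /u/=; lra.
  by under eq_fun do rewrite mulN1r; exact: cvg_cutoff.
Qed.

Lemma annih_stable0 : annih_stable set0.
Proof.
split => // h ah; have := annih_lin 0 0 ah ah.
by congr annih; apply/funext => x; rewrite indic0 !mul0r addr0.
Qed.

Lemma annih_stableC E : annih_stable E -> annih_stable (~` E).
Proof.
move=> [mE aE]; split; first exact: measurableC.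
move=> h ah; have := annih_lin 1 (-1) ah (aE _ ah).
congr annih; apply/funext => x; rewrite !indicE in_setC.
by case: (x \in E) => /=; ring.
Qed.

Lemma annih_stableI E F : annih_stable E -> annih_stable F ->
  annih_stable (E `&` F).
Proof.
move=> [mE aE] [mF aF]; split; first exact: measurableI.
move=> h ah; have := aE _ (aF _ ah); congr annih; apply/funext => x.
by rewrite !indicE in_setI mulrA -natrM mulnb.
Qed.

Lemma annih_stableU E F : annih_stable E -> annih_stable F ->
  annih_stable (E `|` F).
Proof.
move=> aE aF; rewrite -(setCK (_ `|` _)) setCU.
by apply/annih_stableC/annih_stableI; exact: annih_stableC.
Qed.

Lemma annih_stable_null N : measurable N -> mu N = 0%E -> annih_stable N.
Proof.
move=> mN N0; split => // h [mh [B hB] _]; apply: annih_ae0.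
- by apply: measurable_funM.
- exists (1 * B) => x; rewrite normrM ler_pM//.
  by rewrite indicE; case: (_ \in _); rewrite ?normr1 ?normr0.
- exists N; split => // x /= /eqP.
  rewrite indicE; case: (boolP (x \in N)); first by rewrite inE.
  by rewrite mul0r eqxx.
Qed.

(** Finite unions are stable, and at each point their indicators are eventually equal to that of the
    countable union, so [annih_lim] applies. *)
Lemma annih_stable_bigcup (F : (set T)^nat) :
  (forall n, annih_stable (F n)) -> annih_stable (\bigcup_n F n).
Proof.
move=> aF.
have aU n : annih_stable (\bigcup_(i < n) F i).
  elim: n => [|n IH]; first by rewrite bigcup_mkord big_ord0;
    exact: annih_stable0.
  by rewrite bigcup_mkord big_ord_recr/= -bigcup_mkord; exact: annih_stableU.
split; first by apply: bigcup_measurable => n _; case: (aF n).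
move=> h ah; have [_ [B hB] _] := ah.
apply: (@annih_lim (fun n x => \1_(\bigcup_(i < n) F i) x * h x) _ (1 * B)).
- by move=> n; apply: (aU n).2.
- move=> n x; rewrite normrM ler_pM//.
  by rewrite indicE; case: (_ \in _); rewrite ?normr1 ?normr0.
- move=> x; apply: cvgM; last exact: cvg_cst.
  apply: cvg_near_cst.
  have [[n _ Fnx]|nF] := pselect ((\bigcup_n F n) x).
    exists n.+1 => // m /= nm; rewrite !indicE !mem_set//; [by exists n|].
    by exists n.
  near=> m; rewrite !indicE !memNset// => -[k _ Fk]; apply: nF; exists k => //.
Unshelve. all: by end_near. Qed.

Lemma annih_stable_sigma_algebra : sigma_algebra setT annih_stable.
Proof.
split => [|E aE|F aF].
- exact: annih_stable0.
- by rewrite setTD; exact: annih_stableC.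
- exact: annih_stable_bigcup.
Qed.

(** Stability of [E], applied to [h = 1] and tested against [c = 1], says that [f] has integral 0
    over [E]; an integrable function with this property for every measurable [E] is 0 a.e. *)
Lemma annih_stable_ae_eq0 : C (cst 1) -> annih (cst 1) ->
  (forall E, measurable E -> annih_stable E) ->
  {ae mu, forall x, f x = 0}.
Proof.
move=> C1 a1 aE.
have : ae_eq mu setT (EFin \o f) (cst 0%E).
  apply: integral_ae_eq => // E _ mE.
  have [_ _ /(_ _ C1) i0] := (aE E mE).2 _ a1.
  rewrite integral_cst// mul0e integral_mkcond -[LHS]fineK.
    congr EFin; rewrite -i0; congr fine; apply: eq_integral => x _.
    by rewrite patchE indicE mulr1 /= mulr1; case: ifP; rewrite ?mulr1 ?mulr0.
  rewrite -integral_mkcond; apply: integrable_fin_num => //.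
  exact: integrableS fi.
by apply: filterS => x /= /(_ I) [].
Qed.
End annihilator.

(** * Uniqueness of Fourier coefficients on the torus *)

Section torus.
Variable R : realType.
Local Notation Tor d := (d.-tuple (RL R)).
Local Notation P := (torus_prob R).

Lemma measurable_coord d (j : 'I_d) :
  measurable_fun setT (fun t : Tor d => tnth t j : R).
Proof. exact: measurable_tnth. Qed.

Lemma torus_probS d (A : set (Tor d.+1)) :
  P d.+1 A = (unifT R \x P d)%E (@cons_tup R d @^-1` A).
Proof. by []. Qed.

(** The density lives on the closed interval, which meets the complement of the half-open one only
    in the point [- pi]. *)
Lemma unifT_outside : unifT R (~` `]- pi, pi]%classic) = 0%E.
Proof.
apply/eqP; rewrite eq_le measure_ge0 andbT.
rewrite /unifT /= /uniform_prob integral_uniform_pdf.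
rewrite (_ : _ `&` _ = [set - pi]); last first.
  apply/seteqP; split => x /=; rewrite !in_itv/=.
    by move=> [/negP]; rewrite negb_and -!leNgt; lra.
  by move=> ->; rewrite ltxx lexx/=; split => //; have := pi_ge0 R; lra.
by rewrite integral_set1.
Qed.

Lemma torus_coord d (j : 'I_d) (N : set (RL R)) : measurable N ->
  P d ((fun t : Tor d => tnth t j) @^-1` N) = unifT R N.
Proof.
move=> mN; elim: d j => [[]//|d IH] j; rewrite torus_probS.
have [->|j0] := eqVneq j ord0.
  rewrite (_ : _ @^-1` _ = N `*` setT); last first.
    by apply/seteqP; split => [[x t]//=|[x t] []//=].
  by rewrite product_measure1E//= (probability_setT (P d)) mule1.
have [i ->] : exists i, j = lift ord0 i.
  by case: (unliftP ord0 j) j0 => [i ->|->]; [exists i|rewrite eqxx].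
rewrite (_ : _ @^-1` _ = setT `*` ((fun t : Tor d => tnth t i) @^-1` N));
  last first.
  by apply/seteqP; split => [[x t]/=|[x t] []/=]; rewrite tnthS.
rewrite product_measure1E//; last by rewrite -[X in measurable X]setTI;
  exact: measurable_tnth.
by rewrite [X in (X * _)%E](_ : _ = 1%E) ?mul1e;
  [exact: IH|exact: probability_setT].
Qed.

Definition dot d (k : 'I_d -> int) (t : Tor d) : R :=
  \sum_(j < d) (k j)%:~R * (tnth t j : R).

Lemma measurable_dot d (k : 'I_d -> int) : measurable_fun setT (dot k).
Proof.
apply: measurable_sum => j; apply: measurable_funM => //.
exact: measurable_coord.
Qed.

Lemma measurable_cos : measurable_fun setT (@cos R).
Proof. by apply: continuous_measurable_fun; exact: continuous_cos. Qed.

(** The free phase puts the sines in the set as well, so that real test functions suffice. *)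
Definition trig d : set (Tor d -> R) :=
  [set c | exists k phi, c = fun t => cos (dot k t + phi)].

Lemma measurable_trig d (c : Tor d -> R) : trig c -> measurable_fun setT c.
Proof.
move=> [k [phi ->]]; apply: (measurableT_comp measurable_cos).
by apply: measurable_funD => //; exact: measurable_dot.
Qed.

Lemma trig_le1 d (c : Tor d -> R) : trig c -> forall t, `|c t| <= 1.
Proof. by move=> [k [phi ->]] t; rewrite ler_norml cos_geN1 cos_le1. Qed.

(* On [ ]-pi, pi] ] the sets [x < c] are expressed by [cos x] and
   [sin x = cos (x - pi / 2)]. *)
Lemma coord_ltE (c x : R) : - pi < x <= pi -> - pi < c <= pi ->
  (x < c) = if c <= 0 then (cos (x - pi / 2) < 0) && (cos (x + 0) < cos c)
            else (cos (x - pi / 2) < 0) || (cos (x + pi) < - cos c).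
Proof.
move=> /andP[x1 x2] /andP[c1 c2].
have -> : cos (x - pi / 2) = sin x.
  by rewrite cosB cos_pihalf sin_pihalf mulr0 add0r mulr1.
rewrite cosDpi ltrN2 addr0.
have sx : (sin x < 0) = (x < 0).
  have [x0|x0] := ltP x 0.
    by rewrite -[sin x]opprK -sinN oppr_lt0 sin_gt0_pi// oppr_gt0 x0/= ltrNl.
  by apply/negbTE; rewrite -leNgt sin_ge0_pi// x0.
rewrite sx; case: ifPn => [c0|]; last rewrite -ltNge => c0.
  have [x0/=|x0/=] := ltP x 0; last by apply/negbTE;
    rewrite -leNgt (le_trans c0).
  by rewrite -(cosN x) -(cosN c) ltr_cos ?ltrN2// in_itv/=; apply/andP; split;
    lra.
have [x0/=|x0/=] := ltP x 0; first exact: lt_trans c0.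
by rewrite ltr_cos// in_itv/=; apply/andP; split; lra.
Qed.

Lemma mulr_cos (a b : R) :
  cos a * cos b = 2^-1 * cos (b + a) + 2^-1 * cos (b - a).
Proof. by rewrite cosD cosB; field. Qed.

Section uniqueness.
Variables (d : nat) (f : Tor d -> R).
Hypothesis fi : (P d).-integrable setT (EFin \o f).
Local Notation annih := (annih (P d) f (@trig d)).
Local Notation stable := (annih_stable (P d) f (@trig d)).

(** The factor is moved from [h] to the test function: by the product-to-sum formula, its product
    with [cos (<k,t> + phi)] is half the sum of two test functions, of frequencies [k + e_j] and
    [k - e_j]. *)
Lemma annih_mul_cos (j : 'I_d) psi :
  annih_mul (P d) f (@trig d) (fun t => cos (tnth t j + psi : R)).
Proof.
move=> h ah; have [mh [B hB] i0] := ah; split.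
- apply: measurable_funM => //; apply: (measurableT_comp measurable_cos).
  by apply: measurable_funD => //; exact: measurable_coord.
- exists (1 * B) => t; rewrite normrM ler_pM//.
  by rewrite ler_norml cos_geN1 cos_le1.
- move=> _ [k [phi ->]].
  pose kp := fun i => k i + (i == j)%:R; pose km := fun i => k i - (i == j)%:R.
  pose cp (t : Tor d) := cos (dot kp t + (phi + psi)).
  pose cm (t : Tor d) := cos (dot km t + (phi - psi)).
  have tp : trig cp by exists kp, (phi + psi).
  have tm : trig cm by exists km, (phi - psi).
  have jp := annih_integrable fi (@measurable_trig d) (@trig_le1 d) ah tp.
  have jm := annih_integrable fi (@measurable_trig d) (@trig_le1 d) ah tm.
  have dj t : \sum_(i < d) (i == j)%:R%:~R * (tnth t i : R) = tnth t j.
    rewrite (bigD1 j)//= eqxx mul1r big1 ?addr0// => i /negbTE ->.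
    by rewrite mul0r.
  have dp t : dot kp t = dot k t + tnth t j.
    by rewrite -[X in _ + X]dj -big_split/=; apply: eq_bigr => i _;
      rewrite intrD mulrDl.
  have dm t : dot km t = dot k t - tnth t j.
    rewrite -[X in _ - X]dj -sumrN -big_split/=; apply: eq_bigr => i _.
    by rewrite intrB mulrBl.
  under eq_Rintegral.
    move=> t _; rewrite (_ : _ * _ =
      2^-1 * (f t * h t * cp t) + 2^-1 * (f t * h t * cm t)); last first.
      rewrite /cp /cm dp dm.
      rewrite (_ : _ + _ + (phi + psi) = (dot k t + phi) + (tnth t j + psi));
        last by ring.
      rewrite (_ : _ - _ + (phi - psi) = (dot k t + phi) - (tnth t j + psi));
        last by ring.
      rewrite [LHS](_ : _ = f t * h t * (cos (tnth t j + psi) * cos (dot k t +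
        phi))).
        by rewrite mulr_cos mulrDr 2!(mulrCA _ 2^-1).
      by rewrite !mulrA (mulrAC (f t)).
    over.
  rewrite RintegralD//; [|exact: (integrableZl _ _ jp)|exact: (integrableZl _ _
    jm)].
  by rewrite !RintegralZl// i0// i0// !mulr0 addr0.
Qed.

Lemma stable_cos_lt (j : 'I_d) psi t : -1 <= t <= 1 ->
  stable [set x : Tor d | cos (tnth x j + psi : R) < t].
Proof.
move=> t1; apply: (annih_stable_lt fi) => //.
- exact: measurable_trig.
- exact: trig_le1.
- apply: (measurableT_comp measurable_cos).
  by apply: measurable_funD => //; exact: measurable_coord.
- exact: annih_mul_cos.
- by move=> x; rewrite cos_geN1 cos_le1.
Qed.

(** Off the null set [N] where the coordinate leaves []-pi, pi]], [coord_ltE] expresses the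
    half-space by sets that [stable_cos_lt] covers; the part inside [N] is itself null, hence
    stable. *)
Lemma stable_coord_lt (j : 'I_d) c :
  stable [set x : Tor d | (tnth x j : R) < c].
Proof.
pose N := (fun t : Tor d => tnth t j) @^-1` (~` `]- pi, pi]%classic).
have N0 : P d N = 0%E.
  apply: (etrans (torus_coord j _) unifT_outside).
  by apply: measurableC; exact: measurable_itv.
have sN : stable N.
  apply: (annih_stable_null fi).
  - exact: measurable_trig.
  - rewrite -[X in measurable X]setTI; apply: measurable_tnth => //.
    by apply: measurableC; exact: measurable_itv.
  - exact: N0.
have sC := annih_stableC fi (@measurable_trig d) (@trig_le1 d).
have sI := @annih_stableI _ _ _ (P d) f (@trig d).
have sU := annih_stableU fi (@measurable_trig d) (@trig_le1 d).
have s0 := annih_stable0 fi (@measurable_trig d) (@trig_le1 d).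
suff [E sE EE] : exists2 E, stable E &
    [set x : Tor d | (tnth x j : R) < c] `&` ~` N = E `&` ~` N.
  have -> : [set x : Tor d | (tnth x j : R) < c] =
      (E `&` ~` N) `|` ([set x : Tor d | (tnth x j : R) < c] `&` N).
    rewrite -EE; apply/seteqP; split => x /=; last by case=> -[].
    by move=> xc; have [Nx|Nx] := pselect (N x); [right|left].
  apply: sU; first by apply: sI => //; exact: sC.
  apply: (annih_stable_null fi).
  - exact: measurable_trig.
  - apply: measurableI; last by case: sN.
    rewrite -[X in measurable X]setTI; apply: measurable_fun_ltr => //.
    exact: measurable_coord.
  - apply: (@subset_measure0 _ _ _ (P d) _ N) => //.
      apply: measurableI; last by case: sN.
      rewrite -[X in measurable X]setTI; apply: measurable_fun_ltr => //.
      exact: measurable_coord.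
    by case: sN.
have NE (x : Tor d) : ~ N x -> - pi < (tnth x j : R) <= pi.
  by rewrite /N /= => /contrapT; rewrite in_itv.
(* For [c] outside []-pi, pi]] the half-space is, off [N], empty or everything. *)
have [c1|c1] := leP c (- pi).
  exists set0 => //; apply/seteqP; split => x [] // xc /NE /andP[x1 _].
  by have := lt_trans (lt_le_trans xc c1) x1; rewrite ltxx.
have [c2|c2] := ltP pi c.
  exists (~` set0); first exact: sC.
  apply/seteqP; split => x [] _ Nx; split => //=.
  by have /andP[_] := NE _ Nx; move=> /le_lt_trans; exact.
have cc : - pi < c <= pi by rewrite c1 c2.
have s1 : stable [set x : Tor d | cos (tnth x j + - (pi / 2) : R) < 0].
  by apply: stable_cos_lt; rewrite lerN10 ler01.
have [c0|c0] := leP c 0.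
  exists ([set x : Tor d | cos (tnth x j + - (pi / 2) : R) < 0] `&`
          [set x : Tor d | cos (tnth x j + 0 : R) < cos c]).
    by apply: sI => //; apply: stable_cos_lt; rewrite cos_geN1 cos_le1.
  apply/seteqP; split => x [] xc Nx; split => //.
    by move: xc; rewrite /= (coord_ltE (NE _ Nx) cc) c0 => /andP[].
  by move: xc; rewrite /= (coord_ltE (NE _ Nx) cc) c0 => -[-> ->].
exists ([set x : Tor d | cos (tnth x j + - (pi / 2) : R) < 0] `|`
        [set x : Tor d | cos (tnth x j + pi : R) < - cos c]).
  apply: sU => //; apply: stable_cos_lt.
  by rewrite lerN2 lerNl cos_geN1 cos_le1.
apply/seteqP; split => x [] xc Nx; split => //.
  by move: xc; rewrite /= (coord_ltE (NE _ Nx) cc) leNgt c0 => /orP[];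
    [left|right].
by move: xc; rewrite /= (coord_ltE (NE _ Nx) cc) leNgt c0 => -[] ->;
  rewrite ?orbT.
Qed.

Lemma stable_measurable E : measurable E -> stable E.
Proof.
apply: smallest_sub.
  by apply: (annih_stable_sigma_algebra fi);
    [exact: measurable_trig|exact: trig_le1].
(* The sigma-algebra on tuples is generated by preimages under coordinates, and the Borel sets of
   the line by open left rays; the smallest-sigma-algebra argument is run once for each
   generation. *)
move=> A; elim/big_ind : _ => // [B D iB iD [/iB//|/iD//]|j _].
have -> : (measurable : set (set (RL R))) = <<s RGenInftyO.G (R:=R) >>.
  exact: RGenInftyO.measurableE.
rewrite -(@g_sigma_preimageE _ (RL R)); move: A.
apply: smallest_sub.
  by apply: (annih_stable_sigma_algebra fi);
    [exact: measurable_trig|exact: trig_le1].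
move=> _ [_ [c ->] <-].
rewrite setTI; have := stable_coord_lt j c; congr annih_stable.
Qed.

Theorem fourier_uniqueness :
  (forall k phi, \int[P d]_t (f t * cos (dot k t + phi)) = 0) ->
  {ae P d, forall t, f t = 0}.
Proof.
move=> f0; apply: (annih_stable_ae_eq0 fi _ _ stable_measurable).
  exists (fun=> 0), 0; apply/funext => t.
  by rewrite /dot big1 ?addr0 ?cos0// => j _; rewrite mul0r.
split => //; first by exists 1 => t; rewrite normr1.
by move=> _ [k [phi ->]]; under eq_Rintegral do rewrite mulr1; exact: f0.
Qed.
End uniqueness.
End torus.

(** * Reflections and orthogonality *)

Lemma integrable_bounded_prob d (T : measurableType d) (R : realType)
    (Q : probability T R) (f : T -> R) (B : R) :
  measurable_fun setT f -> (forall x, `|f x| <= B) ->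
  Q.-integrable setT (EFin \o f).
Proof.
move=> mf fB; apply: measurable_bounded_integrable => //.
  exact: (le_lt_trans (probability_le1 _ measurableT) (ltry _)).
by exists B; split => [|]; first exact: num_real; move=> M BM x _ /=;
  rewrite (le_trans (fB x)) ?ltW.
Qed.

Section flip.
Variable R : realType.
Local Notation Tor d := (d.-tuple (RL R)).
Local Notation P := (torus_prob R).

Definition flip1 (b : bool) (x : RL R) : RL R := if b then - (x : R) else x.

(** An arbitrary sign pattern treats [negT], [rS] and their composition uniformly. *)
Definition flip d (b : 'I_d -> bool) (t : Tor d) : Tor d :=
  [tuple flip1 (b j) (tnth t j) | j < d].

Lemma measurable_flip1 b : measurable_fun setT (flip1 b).
Proof. by case: b => /=; [exact: oppr_measurable|exact: measurable_id]. Qed.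

Lemma measurable_flip d (b : 'I_d -> bool) : measurable_fun setT (flip b).
Proof.
apply/measurable_fun_tnthP => j.
rewrite (_ : _ \o _ = fun t => flip1 (b j) (tnth t j)); last first.
  by apply/funext => t /=; rewrite tnth_mktuple.
by apply: (measurableT_comp (measurable_flip1 _)); exact: measurable_tnth.
Qed.

(** Both the density and Lebesgue measure are invariant under [x -> - x]. *)
Lemma unifT_flip1 b (A : set (RL R)) : measurable A ->
  unifT R (flip1 b @^-1` A) = unifT R A.
Proof.
case: b => // mA; rewrite /unifT /= /uniform_prob.
transitivity (\int[lebesgue_measure]_(x in
    (-%R : R -> measurableTypeR R) @^-1` A)
   ((EFin \o uniform_pdf (- pi) pi) \o (-%R : R -> measurableTypeR R)) x)%E.
  apply: eq_integral => x _ /=; congr EFin; rewrite /uniform_pdf.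
  by rewrite lerN2 lerNl andbC.
rewrite -ge0_integral_pushforward//=.
- by apply: eq_measure_integral => B mB BA; exact: lebesgue_measureN.
- by apply: measurable_funTS; apply/measurable_EFinP;
    exact: measurable_uniform_pdf.
- by move=> x _; rewrite lee_fin uniform_pdf_ge0// Npi_lt_pi.
Qed.

(** A flip acts separately on head and tail, so the image of the product measure agrees with it on
    rectangles, and such a measure is unique. *)
Lemma torus_flip d (b : 'I_d -> bool) (A : set (Tor d)) : measurable A ->
  P d (flip b @^-1` A) = P d A.
Proof.
elim: d b A => [|d IH] b A mA.
  congr (P 0 _); apply/seteqP; split => t /=;
    by rewrite (tuple0 (flip b t)) (tuple0 t).
rewrite !torus_probS.
pose g (p : RL R * Tor d) : RL R * Tor d :=
  (flip1 (b ord0) p.1, flip (fun j => b (lift ord0 j)) p.2).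
have mg : measurable_fun setT g.
  apply: measurable_fun_pair.
    by apply: (measurableT_comp (measurable_flip1 _)); exact: measurable_fst.
  by apply: (measurableT_comp (measurable_flip _)); exact: measurable_snd.
have -> : cons_tup (n:=d) @^-1` (flip b @^-1` A) =
  g @^-1` (cons_tup (n:=d) @^-1` A).
  have gE (p : RL R * Tor d) : flip b (cons_tup p) = cons_tup (g p).
    apply: eq_from_tnth => j; rewrite tnth_mktuple.
    by case: (unliftP ord0 j) => [i ->|->]; rewrite ?tnthS ?tnth_mktuple ?tnth0.
  by apply/seteqP; split => p /=; rewrite gE.
pose m := distribution (unifT R \x P d)%E (mfun_Sub (mem_set mg)).
have mB : measurable (cons_tup (n:=d) @^-1` A).
  by rewrite -[X in measurable X]setTI; exact: measurable_cons_tup.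
apply/esym; apply: (@product_measure_unique _ _ _ _ _ _ _ m) => //.
move=> X Y mX mY.
rewrite /m /= /pushforward.
rewrite (_ : _ @^-1` _ =
  (flip1 (b ord0) @^-1` X) `*` (flip (fun j => b (lift ord0 j)) @^-1` Y)) //.
rewrite [LHS]product_measure1E; last 2 first.
- by rewrite -[X in measurable X]setTI; exact: measurable_flip1.
- by rewrite -[X in measurable X]setTI; exact: measurable_flip.
by congr (_ * _)%E; [exact: unifT_flip1|exact: IH].
Qed.

Lemma integrable_flip d (b : 'I_d -> bool) (f : Tor d -> R) :
  (P d).-integrable setT (EFin \o f) ->
  (P d).-integrable setT (EFin \o (fun t => f (flip b t))).
Proof.
move=> fi; apply/integrableP; split.
  apply: (measurableT_comp (measurable_int _ fi)); exact: measurable_flip.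
have [mf] := integrableP _ _ _ fi; apply: le_lt_trans.
rewrite -(@ge0_integral_pushforward _ _ _ _ _ (flip b) (measurable_flip b)
  (P d) setT (fun t => `|(EFin \o f) t|%E))//.
- by rewrite le_eqVlt; apply/orP; left; apply/eqP;
    apply: eq_measure_integral => [|mphi A mA _];
    [exact: measurable_flip|exact: (torus_flip b mA)].
- exact: measurableT_comp.
Qed.

Lemma Rintegral_flip d (b : 'I_d -> bool) (f : Tor d -> R) :
  (P d).-integrable setT (EFin \o f) ->
  \int[P d]_t f (flip b t) = \int[P d]_t f t.
Proof.
move=> fi; congr fine.
rewrite -(@integral_pushforward _ _ _ _ _ (flip b) (measurable_flip b)
  (P d) setT (EFin \o f))//.
- by apply: eq_measure_integral => [|mphi A mA _];
    [exact: measurable_flip|exact: (torus_flip b mA)].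
- exact: measurable_int fi.
- exact: integrable_flip.
Qed.

Lemma sin_intpi (k : int) : sin (k%:~R * pi) = 0 :> R.
Proof.
have natpi n : sin (n%:R * pi) = 0 :> R.
  elim: n => [|n IH]; first by rewrite mul0r sin0.
  by rewrite -natr1 mulrDl mul1r sinD sinpi cospi IH mul0r mulr0 addr0.
by case: k => n; rewrite ?NegzE ?mulrNz ?mulNr ?sinN ?natpi ?oppr0.
Qed.

Lemma is_derive_sin_affine (k : int) (phi x : R) : k != 0 ->
  is_derive x 1 (fun y : R => y + k%:~R^-1 * sin (k%:~R * y + phi))
    (1 + cos (k%:~R * x + phi)).
Proof.
move=> k0; have kR : k%:~R != 0 :> R by rewrite intr_eq0.
apply: is_derive_eq.
by rewrite /GRing.scale /= addr0 mulr1 (mulrC (cos _)) mulrA mulVf// mul1r.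
Qed.

Lemma unifT_cos (k : int) (phi : R) : k != 0 ->
  (\int[unifT R]_x (cos (k%:~R * x + phi))%:E = 0)%E.
Proof.
move=> k0.
have mc : measurable_fun setT (fun x : RL R => cos (k%:~R * x + phi : R)).
  apply: (measurableT_comp (@measurable_cos R)).
  by apply: measurable_funD => //; apply: measurable_funM => //;
    exact: measurable_id.
have ci : (unifT R).-integrable setT
    (fun x : RL R => (cos (k%:~R * x + phi : R))%:E).
  apply: (@integrable_bounded_prob _ _ _ (unifT R) _ 1 mc) => x.
  by rewrite ler_norml cos_geN1 cos_le1.
(* Adding 1 makes the integrand nonnegative, as [integral_uniform] demands; it is subtracted again
   at the end. *)
have : (\int[unifT R]_x (1 + cos (k%:~R * x + phi))%:E = 1)%E.
  rewrite integral_uniform/=; last 2 first.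
  - by apply/measurable_EFinP; exact: measurable_funD.
  - by move=> x; rewrite lee_fin -lerBlDl sub0r cos_geN1.
  have kR : k%:~R != 0 :> R by rewrite intr_eq0.
  have p0 := pi_gt0 R.
  have dF x := @is_derive_sin_affine k phi x k0.
  have cF x : (y + k%:~R^-1 * sin (k%:~R * y + phi)) @[y --> x] -->
      x + k%:~R^-1 * sin (k%:~R * x + phi).
    apply: cvgD; first exact: cvg_id.
    apply: cvgM; first exact: cvg_cst.
    apply: (@continuous_comp _ _ _ (fun y : R => k%:~R * y + phi) _ x);
      last exact: continuous_sin.
    apply: cvgD; last exact: cvg_cst.
    by apply: cvgM; [exact: cvg_cst|exact: cvg_id].
  rewrite (@continuous_FTC2 _ _
    (fun y : R => y + k%:~R^-1 * sin (k%:~R * y + phi))).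
  (* The sine takes the same value at both ends because [sin (k pi) = 0], so only the length [2 pi]
     remains and the normalization cancels it. *)
  - rewrite -EFinB -EFinM; congr EFin.
    rewrite !sinD mulrN cosN sinN sin_intpi; field.
    by apply/andP; split; [exact: kR|apply: lt0r_neq0; lra].
  - exact: Npi_lt_pi.
  - apply: continuous_subspaceT => x.
    apply: cvgD; first exact: cvg_cst.
    apply: (@continuous_comp _ _ _ (fun y : R => k%:~R * y + phi) _ x);
      last exact: continuous_cos.
    apply: cvgD; last exact: cvg_cst.
    by apply: cvgM; [exact: cvg_cst|exact: cvg_id].
  - split.
    + by move=> x _; apply: ex_derive.
    + by apply: cvg_at_right_filter; exact: cF.
    + by apply: cvg_at_left_filter; exact: cF.
  - by move=> x _; rewrite derive1E; apply: derive_val.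
under eq_integral do rewrite EFinD.
rewrite integralD//; last first.
  by apply: (@integrable_bounded_prob _ _ _ (unifT R) (cst 1) 1) => // x;
    rewrite normr1.
rewrite integral_cst// [X in (_ * X)%E](_ : _ = 1%E) ?mule1;
  last exact: probability_setT.
have fc := integrable_fin_num measurableT ci.
by rewrite -(fineK fc) -EFinD => -[] c1; congr EFin; lra.
Qed.

(** Fubini with the tail integrated first: the head coordinate then only shifts the phase, which is
    why [phi] is arbitrary in the induction. *)
Lemma torus_cos d (k : 'I_d -> int) (phi : R) :
  (\int[P d]_t (cos (dot k t + phi))%:E =
   (if [forall j, k j == 0] then cos phi else 0)%:E)%E.
Proof.
elim: d k phi => [|d IH] k phi.
  rewrite [LHS]integral_dirac//=; last first.
    by apply/measurable_EFinP; apply: measurable_trig; exists k, phi.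
  rewrite diracT mul1e /dot big_ord0 add0r.
  by case: ifPn => // /forallPn[[]].
have mc : measurable_fun setT (fun t : Tor d.+1 => cos (dot k t + phi)).
  by apply: measurable_trig; exists k, phi.
have ci : (unifT R \x P d)%E.-integrable setT
   ((fun t : Tor d.+1 => (cos (dot k t + phi))%:E) \o @cons_tup R d).
  apply: (@integrable_bounded_prob _ _ _ (unifT R \x P d)%E
            (fun p => cos (dot k (cons_tup p) + phi)) 1).
  - by apply: (measurableT_comp mc); exact: measurable_cons_tup.
  - by move=> x; rewrite ler_norml cos_geN1 cos_le1.
rewrite [LHS]integral_distribution//; last exact/measurable_EFinP.
rewrite -[LHS](integral12_prod_meas1 ci) /fubini_F /=.
pose k' j := k (lift ord0 j).
have dE x (t : Tor d) :
    dot k (cons_tup (x, t)) + phi = dot k' t + ((k ord0)%:~R * x + phi).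
  rewrite /dot big_ord_recl tnth0 addrAC addrC; congr (_ + _).
  by apply: eq_bigr => j _; rewrite tnthS.
under eq_integral do under eq_integral do rewrite dE.
under eq_integral do rewrite IH.
have -> : [forall j, k j == 0] = (k ord0 == 0) && [forall j, k' j == 0].
  apply/forallP/andP => [k0|[k0 /forallP k'0] j].
    by split; [exact: k0|apply/forallP => j; exact: k0].
  by case: (unliftP ord0 j) => [i ->|->]; [exact: k'0|].
case: [forall j, _]; last by rewrite andbF integral0.
rewrite andbT.
have [->/=|k0/=] := eqVneq (k ord0) 0.
  under eq_integral do rewrite mul0r add0r.
  by rewrite integral_cst// [X in (_ * X)%E](_ : _ = 1%E) ?mule1//;
    exact: probability_setT.
exact: unifT_cos.
Qed.
End flip.

(** * Rayleigh bounds for Hermitian matrices *)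

Section rayleigh.
Local Open Scope sesquilinear_scope.
Variables (R : realType) (n : nat) (G : 'M[R[i]]_n).
Hypothesis Gherm : forall i j, G j i = conjc (G i j).

Let Q := spectralmx G.
Let D := spectral_diag G.

Lemma herm_hermsymmx : G \is hermsymmx.
Proof.
apply/is_hermitianmxP; rewrite expr0 scale1r; apply/matrixP => i j.
by rewrite !mxE Gherm.
Qed.

Lemma herm_spectral : G = invmx Q *m diag_mx D *m Q.
Proof. by apply/orthomx_spectralP;
  exact: hermitian_normalmx herm_hermsymmx. Qed.

Lemma herm_diag_real i : D 0 i = ((complex.Re (D 0 i))%:C)%C.
Proof.
have /mxOverP/(_ 0 i) := hermitian_spectral_diag_real herm_hermsymmx.
by move=> /RRe_real.
Qed.

Lemma herm_mul_spectral : Q *m G = diag_mx D *m Q.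
Proof. by rewrite {1}herm_spectral !mulmxA mulmxV ?spectral_unit// mul1mx. Qed.

Lemma herm_mul_invmx : G *m invmx Q = invmx Q *m diag_mx D.
Proof. by rewrite {1}herm_spectral -!mulmxA mulmxV ?spectral_unit// mulmx1. Qed.

Lemma herm_diag_eigenvalue i : eigenvalue G (D 0 i).
Proof.
apply/eigenvalueP; exists (row i Q).
  by rewrite -row_mul herm_mul_spectral mul_diag_mx; apply/rowP => j;
    rewrite !mxE.
apply/eqP => q0.
have : row i (Q *m invmx Q) = 0 by rewrite row_mul q0 mul0mx.
rewrite mulmxV ?spectral_unit// => /rowP/(_ i)/eqP.
by rewrite !mxE eqxx oner_eq0.
Qed.

(** In the spectral basis the eigenvector equation reads [w_i D_i = a w_i], and some [w_i] is
    nonzero. *)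
Lemma herm_eigenvalue_diag (a : R[i]) : eigenvalue G a -> exists i, a = D 0 i.
Proof.
move=> /eigenvalueP[v vG v0].
pose w := v *m invmx Q.
have wD : w *m diag_mx D = a *: w.
  by rewrite /w -mulmxA -herm_mul_invmx mulmxA vG scalemxAl.
have w0 : w != 0.
  apply: contraNneq v0 => w0.
  by rewrite -[v](mulmxKV (spectral_unit G)) -/w w0 mul0mx.
clearbody w; have [i wi] : exists i, w 0 i != 0.
  apply/existsP; apply: contraNT w0; rewrite negb_exists => /forallP w0.
  by apply/eqP/rowP => i; rewrite [RHS]mxE; apply/eqP/negbNE.
exists i; have /rowP/(_ i) := wD; rewrite mul_mx_diag !mxE.
by move=> e; apply: (mulIf wi); rewrite -e mulrC.
Qed.

(** Makes the [inf] and [sup] in [lam_min] and [lam_max] genuine bounds, rather than default values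
    on an unbounded set. *)
Lemma eigenvalue_bounded r : eigenvalue G (r%:C)%C ->
  `|r| <= \sum_i `|complex.Re (D 0 i)|.
Proof.
move=> rG; have [k] := herm_eigenvalue_diag rG; rewrite herm_diag_real => -[->].
by rewrite (bigD1 k)//= lerDl sumr_ge0.
Qed.

Lemma lam_min_le i : lam_min G <= complex.Re (D 0 i).
Proof.
apply: ge_inf => /=.
  exists (- \sum_i `|complex.Re (D 0 i)|) => r /= /eigenvalue_bounded.
  by rewrite ler_norml => /andP[].
by rewrite -herm_diag_real; exact: herm_diag_eigenvalue.
Qed.

Lemma le_lam_max i : complex.Re (D 0 i) <= lam_max G.
Proof.
apply: ub_le_sup => /=.
  exists (\sum_i `|complex.Re (D 0 i)|) => r /= /eigenvalue_bounded.
  by rewrite ler_norml => /andP[].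
by rewrite -herm_diag_real; exact: herm_diag_eigenvalue.
Qed.

(** The weights are [c_i = |w_i|^2] for [w = u Q^-1]; as [Q] is unitary they add up to [|u|^2], and
    the form is diagonal in [w]. *)
Lemma rayleigh_diag (u : 'rV[R[i]]_n) : exists c : 'I_n -> R,
  [/\ forall i, 0 <= c i,
      complex.Re (\sum_i u 0 i * conjc (u 0 i)) = \sum_i c i &
      complex.Re (\sum_i \sum_j u 0 i * G i j * conjc (u 0 j)) =
      \sum_i complex.Re (D 0 i) * c i].
Proof.
pose w := u *m invmx Q.
have wE : w ^t* = Q *m u ^t*.
  rewrite /w invmx_unitary ?spectral_unitarymx// trmx_mul map_mxM.
  by rewrite -/(Q ^t* ^t*) trmxCK.
have normE (x : 'rV[R[i]]_n) : \sum_i x 0 i * conjc (x 0 i) = (x *m x ^t*) 0 0.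
  by rewrite mxE; apply: eq_bigr => i _; rewrite !mxE.
exists (fun i => complex.Re (w 0 i * conjc (w 0 i))); split.
- move=> i; have := mulcJ_ge0 (w 0 i); rewrite lecE => /andP[_]; exact.
- rewrite -raddf_sum/= !normE wE /w !mulmxA mulmxKV//.
  exact: spectral_unit.
- rewrite exchange_big/=.
  transitivity (complex.Re ((u *m G *m u ^t*) 0 0)).
    congr complex.Re; rewrite mxE; apply: eq_bigr => j _.
    by rewrite !mxE mulr_suml.
  rewrite herm_spectral !mulmxA -mulmxA -wE -/w mul_mx_diag mxE raddf_sum/=.
  apply: eq_bigr => i _; rewrite !mxE mulrAC mulrC [D 0 i]herm_diag_real.
  by case: (\sum_j _) => x y /=; ring.
Qed.

Lemma rayleigh_bounds (u : 'rV[R[i]]_n) :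
  let N := complex.Re (\sum_i u 0 i * conjc (u 0 i)) in
  lam_min G * N <= complex.Re (\sum_i \sum_j u 0 i * G i j * conjc (u 0 j)) <=
    lam_max G * N.
Proof.
have [c [c0 -> ->]] := rayleigh_diag u; rewrite /= !mulr_sumr.
by apply/andP; split; apply: ler_sum => i _;
  rewrite ler_wpM2r// ?lam_min_le ?le_lam_max.
Qed.
End rayleigh.

(** * Integration of complex functions on the torus *)

Section cint.
Variables (R : realType) (d : nat).
Local Notation Tor := (d.-tuple (RL R)).
Local Notation P := (torus_prob R d).
Local Notation Re := complex.Re.
Local Notation Im := complex.Im.
Implicit Types (g h : Tor -> R[i]) (c : R[i]).

Lemma cReD (x y : R[i]) : Re (x + y) = Re x + Re y.
Proof. by case: x y => [? ?] [? ?]. Qed.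

Lemma cImD (x y : R[i]) : Im (x + y) = Im x + Im y.
Proof. by case: x y => [? ?] [? ?]. Qed.

Lemma cReM (x y : R[i]) : Re (x * y) = Re x * Re y - Im x * Im y.
Proof. by case: x y => [? ?] [? ?]. Qed.

Lemma cImM (x y : R[i]) : Im (x * y) = Re x * Im y + Im x * Re y.
Proof. by case: x y => [? ?] [? ?]. Qed.

Lemma cRe_sum (I : Type) (r : seq I) (p : pred I) (F : I -> R[i]) :
  Re (\sum_(i <- r | p i) F i) = \sum_(i <- r | p i) Re (F i).
Proof. exact: (big_morph _ cReD). Qed.

Lemma conjcD (x y : R[i]) : conjc (x + y) = conjc x + conjc y.
Proof. exact: rmorphD. Qed.

Lemma conjcM (x y : R[i]) : conjc (x * y) = conjc x * conjc y.
Proof. exact: rmorphM. Qed.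

Lemma conjc_sum (I : Type) (r : seq I) (F : I -> R[i]) :
  conjc (\sum_(i <- r) F i) = \sum_(i <- r) conjc (F i).
Proof. exact: rmorph_sum. Qed.

Lemma expiD (a b : R) : expi (a + b) = expi a * expi b.
Proof.
by rewrite /expi cosD sinD; apply/eqP;
  rewrite eq_complex /= eqxx (addrC (sin a * _)) eqxx.
Qed.

Lemma conjc_expi (a : R) : conjc (expi a) = expi (- a).
Proof. by rewrite /expi cosN sinN. Qed.

Definition cintegrable g : Prop :=
  P.-integrable setT (EFin \o (fun t => Re (g t))) /\
  P.-integrable setT (EFin \o (fun t => Im (g t))).

Lemma integrable_lin (f1 f2 : Tor -> R) a b :
  P.-integrable setT (EFin \o f1) -> P.-integrable setT (EFin \o f2) ->
  P.-integrable setT (EFin \o (fun t => a * f1 t + b * f2 t)).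
Proof.
move=> i1 i2.
exact: (integrableD measurableT (integrableZl measurableT a i1)
  (integrableZl measurableT b i2)).
Qed.

Lemma Rintegral_lin (f1 f2 : Tor -> R) a b :
  P.-integrable setT (EFin \o f1) -> P.-integrable setT (EFin \o f2) ->
  \int[P]_t (a * f1 t + b * f2 t) = a * \int[P]_t f1 t + b * \int[P]_t f2 t.
Proof.
move=> i1 i2; rewrite RintegralD//;
  [|exact: (integrableZl _ _ i1)|exact: (integrableZl _ _ i2)].
by rewrite !RintegralZl.
Qed.

Lemma eq_cint g h : g =1 h -> cint g = cint h.
Proof. by move=> /funext ->. Qed.

Lemma eq_cintegrable g h : g =1 h -> cintegrable g -> cintegrable h.
Proof. by move=> /funext ->. Qed.

Lemma cintegrableZ c g : cintegrable g -> cintegrable (fun t => c * g t).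
Proof.
move=> [gr gi]; split.
  have := integrable_lin (Re c) (- Im c) gr gi; congr integrable.
  by apply/funext => t /=; rewrite cReM mulNr.
have := integrable_lin (Re c) (Im c) gi gr; congr integrable.
by apply/funext => t /=; rewrite cImM.
Qed.

Lemma cintZ c g : cintegrable g -> cint (fun t => c * g t) = c * cint g.
Proof.
move=> [gr gi]; apply/eqP; rewrite eq_complex cReM cImM /=; apply/andP; split;
  apply/eqP.
  rewrite -mulNr -Rintegral_lin//; apply: eq_Rintegral => t _.
  by rewrite cReM mulNr.
by rewrite -Rintegral_lin//; apply: eq_Rintegral => t _; rewrite cImM.
Qed.

Lemma cintegrableD g h : cintegrable g -> cintegrable h ->
  cintegrable (fun t => g t + h t).
Proof.
move=> [gr gi] [hr hi]; split.
  have := integrable_lin 1 1 gr hr; congr integrable.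
  by apply/funext => t /=; rewrite cReD !mul1r.
have := integrable_lin 1 1 gi hi; congr integrable.
by apply/funext => t /=; rewrite cImD !mul1r.
Qed.

Lemma cintD g h : cintegrable g -> cintegrable h ->
  cint (fun t => g t + h t) = cint g + cint h.
Proof.
move=> [gr gi] [hr hi]; apply/eqP; rewrite eq_complex cReD cImD /=; apply/andP;
  split; apply/eqP.
  by rewrite -RintegralD//; apply: eq_Rintegral => t _; rewrite cReD.
by rewrite -RintegralD//; apply: eq_Rintegral => t _; rewrite cImD.
Qed.

Lemma cintegrable0 : cintegrable (fun=> 0).
Proof. by split; exact: integrable0. Qed.

Lemma cint0 : @cint R d (fun=> 0) = 0.
Proof. by rewrite /cint /Rintegral /= integral0. Qed.

Lemma cintegrable_sum (I : Type) (r : seq I) (F : I -> Tor -> R[i]) :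
  (forall i, cintegrable (F i)) -> cintegrable (fun t => \sum_(i <- r) F i t).
Proof.
move=> iF; elim: r => [|i r IH].
  by apply: eq_cintegrable cintegrable0 => t; rewrite big_nil.
by apply: eq_cintegrable (cintegrableD (iF i) IH) => t; rewrite big_cons.
Qed.

Lemma cint_sum (I : Type) (r : seq I) (F : I -> Tor -> R[i]) :
  (forall i, cintegrable (F i)) ->
  cint (fun t => \sum_(i <- r) F i t) = \sum_(i <- r) cint (F i).
Proof.
move=> iF; elim: r => [|i r IH].
  by rewrite big_nil; apply: etrans cint0; apply: eq_cint => t; rewrite big_nil.
rewrite big_cons -IH -cintD//; last exact: cintegrable_sum.
by apply: eq_cint => t; rewrite big_cons.
Qed.

Lemma cintegrable_conj g : cintegrable g -> cintegrable (fun t => conjc (g t)).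
Proof.
move=> [gr gi]; split.
  by have := gr; congr integrable; apply/funext => t /=; case: (g t).
have := integrable_lin 0 (-1) gr gi; congr integrable.
by apply/funext => t /=; case: (g t) => x y /=; rewrite mul0r add0r mulN1r.
Qed.

Lemma cint_conj g : cintegrable g ->
  cint (fun t => conjc (g t)) = conjc (cint g).
Proof.
move=> [gr gi]; apply/eqP; rewrite eq_complex /=; apply/andP; split; apply/eqP.
  by apply: eq_Rintegral => t _; case: (g t).
rewrite -mulN1r -RintegralZl//; apply: eq_Rintegral => t _.
by case: (g t) => x y /=; rewrite mulN1r.
Qed.

Lemma cintegrable_flip b g : cintegrable g ->
  cintegrable (fun t => g (flip b t)).
Proof. by move=> [gr gi]; split;
  [exact: (integrable_flip b gr)|exact: (integrable_flip b gi)]. Qed.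

Lemma cint_flip b g : cintegrable g -> cint (fun t => g (flip b t)) = cint g.
Proof.
move=> [gr gi]; rewrite /cint; congr Complex.
  exact: (Rintegral_flip b gr).
exact: (Rintegral_flip b gi).
Qed.

Lemma measurable_cos_dot (k : 'I_d -> int) phi :
  measurable_fun setT (fun t : Tor => cos (dot k t + phi)).
Proof. by apply: measurable_trig; exists k, phi. Qed.

Lemma sin_cos_shift (x : R) : sin x = cos (x + (- (pi / 2))).
Proof. by rewrite cosB cos_pihalf sin_pihalf mulr0 add0r mulr1. Qed.

Lemma integrable_mul_cos k phi (f : Tor -> R) :
  P.-integrable setT (EFin \o f) ->
  P.-integrable setT (EFin \o (fun t => f t * cos (dot k t + phi))).
Proof.
move=> fi; apply: (integrable_mul_bounded (B := 1)) fi _ _.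
  exact: measurable_cos_dot.
by move=> t; rewrite ler_norml cos_geN1 cos_le1.
Qed.

Lemma cintegrable_expi (k : 'I_d -> int) g :
  cintegrable g -> cintegrable (fun t => g t * expi (dot k t)).
Proof.
move=> [gr gi]; split.
  have := integrable_lin 1 (-1) (integrable_mul_cos k 0 gr)
    (integrable_mul_cos k (- (pi / 2)) gi); congr integrable.
  by apply/funext => t /=; rewrite cReM -sin_cos_shift addr0 mul1r mulN1r.
have := integrable_lin 1 1 (integrable_mul_cos k (- (pi / 2)) gr)
  (integrable_mul_cos k 0 gi); congr integrable.
by apply/funext => t /=; rewrite cImM -sin_cos_shift addr0 !mul1r.
Qed.

Lemma dotN (k : 'I_d -> int) (t : Tor) : dot (fun j => - k j) t = - dot k t.
Proof.
by rewrite /dot -sumrN; apply: eq_bigr => j _; rewrite mulrNz mulNr.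
Qed.

Lemma cintegrable1 : cintegrable (fun=> 1).
Proof.
by split; apply: (@integrable_bounded_prob _ _ _ P _ 1) => // t;
  rewrite ?normr1 ?normr0.
Qed.

Lemma cint_expi (k : 'I_d -> int) :
  cint (fun t => expi (dot k t)) = ([forall j, k j == 0]%:R : R[i]).
Proof.
rewrite /cint /expi /Rintegral /=.
under eq_integral do rewrite -[dot k _]addr0.
rewrite torus_cos cos0.
under eq_integral do rewrite sin_cos_shift.
rewrite torus_cos cosN cos_pihalf /=.
by case: ifP.
Qed.

(** Reduces to the real theorem for the real and imaginary parts, whose coefficients are separated
    by comparing [k] with [- k]. *)
Lemma cint_fourier_uniqueness g : cintegrable g ->
  (forall k, cint (fun t => g t * expi (dot k t)) = 0) ->
  {ae P, forall t, g t = 0}.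
Proof.
move=> gint g0; have [gr gi] := gint.
pose gR t := Re (g t); pose gI t := Im (g t).
pose C (f : Tor -> R) k := \int[P]_t (f t * cos (dot k t + 0)).
pose S (f : Tor -> R) k := \int[P]_t (f t * cos (dot k t + - (pi / 2))).
have E k : C gR k - S gI k = 0 /\ S gR k + C gI k = 0.
  have := g0 k => -[e1 e2]; split.
    rewrite -[RHS]e1 -[X in _ - X]mul1r -[X in X - _]mul1r -mulNr
      -Rintegral_lin; [|exact: integrable_mul_cos..].
    by apply: eq_Rintegral => t _ /=;
      rewrite cReM -sin_cos_shift addr0 mul1r mulN1r.
  rewrite -[RHS]e2 -[X in _ + X]mul1r -[X in X + _]mul1r -Rintegral_lin;
    [|exact: integrable_mul_cos..].
  by apply: eq_Rintegral => t _ /=; rewrite cImM -sin_cos_shift addr0 !mul1r.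
have CN f k : C f (fun j => - k j) = C f k.
  by apply: eq_Rintegral => t _; rewrite dotN !addr0 cosN.
have SN f k : P.-integrable setT (EFin \o f) -> S f (fun j => - k j) = - S f k.
  move=> fi; rewrite -mulN1r -RintegralZl//; last exact: integrable_mul_cos.
  by apply: eq_Rintegral => t _; rewrite -!sin_cos_shift dotN sinN mulrN mulN1r.
(* [C] is even and [S] is odd in [k], so the two equations at [k] and the two at [- k] form an
   invertible linear system. *)
have CS0 k : [/\ C gR k = 0, S gR k = 0, C gI k = 0 & S gI k = 0].
  have [e1 e2] := E k; have := E (fun j => - k j).
  by rewrite !CN !SN// => -[e3 e4]; split; lra.
have ae0 f : P.-integrable setT (EFin \o f) ->
  (forall k, C f k = 0 /\ S f k = 0) ->
    {ae P, forall t, f t = 0}.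
  move=> fi f0; apply: fourier_uniqueness => // k phi.
  have [c0 s0] := f0 k.
  transitivity (cos phi * C f k + (- sin phi) * S f k);
    last by rewrite c0 s0 !mulr0 addr0.
  rewrite -Rintegral_lin; [|exact: integrable_mul_cos..].
  apply: eq_Rintegral => t _; rewrite -sin_cos_shift addr0 cosD; ring.
have hr : {ae P, forall t, Re (g t) = 0} by apply: ae0 => // k;
  have [] := CS0 k.
have hi : {ae P, forall t, Im (g t) = 0} by apply: ae0 => // k;
  have [] := CS0 k.
by apply: filterS2 hr hi => t; case: (g t) => x y /= -> ->.
Qed.

Lemma Rintegral_ae_ge0 (f : Tor -> R) : P.-integrable setT (EFin \o f) ->
  {ae P, forall t, 0 <= f t} -> 0 <= \int[P]_t f t.
Proof.
move=> fi f0; have mf : measurable_fun setT (EFin \o f) := measurable_int _ fi.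
(* The positive part of [f] equals [f] a.e. and is nonnegative everywhere. *)
rewrite /Rintegral (@ae_eq_integral _ _ _ P setT (fun t => (Num.max (f t)
  0)%:E))//.
- by apply: Rintegral_ge0 => t _; rewrite le_max lexx orbT.
- apply/measurable_EFinP; apply: measurable_maxr => //; exact/measurable_EFinP.
- by apply: filterS f0 => t /= ft _; rewrite max_l.
Qed.
End cint.

(** * Hermitian quaternion matrices *)

Section quaternion.
Variable R : realType.
Implicit Types p q r : quat R.

Lemma qmulDl p q r : qmul (p + q) r = qmul p r + qmul q r.
Proof. by rewrite /qmul; congr pair => /=; ring. Qed.

Lemma qmulDr p q r : qmul p (q + r) = qmul p q + qmul p r.
Proof. by rewrite /qmul; congr pair => /=; rewrite !rmorphD; ring. Qed.

Lemma qmul0r q : qmul 0 q = 0.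
Proof. by rewrite /qmul; congr pair => /=; ring. Qed.

Lemma qmulr0 q : qmul q 0 = 0.
Proof. by rewrite /qmul; congr pair => /=; rewrite rmorph0; ring. Qed.

Lemma qmulA p q r : qmul p (qmul q r) = qmul (qmul p q) r.
Proof.
case: p q r => [[p1 p2] [p3 p4]] [[q1 q2] [q3 q4]] [[r1 r2] [r3 r4]].
by rewrite /qmul; congr pair; apply/eqP; rewrite eq_complex /=;
  apply/andP; split; apply/eqP; ring.
Qed.

Lemma qconjD p q : qconj (p + q) = qconj p + qconj q.
Proof. by rewrite /qconj; congr pair => /=; rewrite ?rmorphD ?opprD. Qed.

Lemma qconj0 : qconj 0 = 0 :> quat R.
Proof. by rewrite /qconj; congr pair => /=; rewrite ?rmorph0 ?oppr0. Qed.

Lemma qconjM p q : qconj (qmul p q) = qmul (qconj q) (qconj p).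
Proof.
rewrite /qconj /qmul; congr pair => /=;
  rewrite ?(rmorphD, rmorphB, rmorphM, rmorphN) /= ?conjCK; ring.
Qed.

Lemma qconjK p : qconj (qconj p) = p.
Proof. by case: p => z w; rewrite /qconj /= conjCK opprK. Qed.

Lemma qmul_suml (I : Type) (s : seq I) (F : I -> quat R) q :
  qmul (\sum_(a <- s) F a) q = \sum_(a <- s) qmul (F a) q.
Proof. by apply: (big_morph (fun p => qmul p q)) => [p r|];
  rewrite ?qmulDl ?qmul0r. Qed.

Lemma qmul_sumr (I : Type) (s : seq I) (F : I -> quat R) q :
  qmul q (\sum_(a <- s) F a) = \sum_(a <- s) qmul q (F a).
Proof. by apply: (big_morph (qmul q)) => [p r|]; rewrite ?qmulDr ?qmulr0. Qed.

Definition qnorm2 q : R := complex.Re (q.1 * conjc q.1 + q.2 * conjc q.2).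

Lemma qconj_mul q : qmul (qconj q) q = ((qnorm2 q)%:C%C, 0).
Proof.
case: q => [[a b] [c e]]; rewrite /qmul /qconj /qnorm2 /=.
by congr pair; apply/eqP; rewrite eq_complex /=; apply/andP; split; apply/eqP;
  ring.
Qed.

Lemma qnorm2_ge0 q : 0 <= qnorm2 q.
Proof. by case: q => [[a b] [c e]]; rewrite /qnorm2 /=; nra. Qed.

Lemma qnorm2_eq0 q : qnorm2 q = 0 -> q = 0.
Proof.
case: q => [[a b] [c e]]; rewrite /qnorm2 /= => h.
have [-> -> -> ->] : [/\ a = 0, b = 0, c = 0 & e = 0].
  by split; apply/eqP; rewrite -sqrf_eq0; apply/eqP; nra.
by [].
Qed.

Lemma qreal_mul (a : R) q : qmul (a%:C%C, 0) q = (a%:C%C * q.1, a%:C%C * q.2).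
Proof. by rewrite /qmul /=; congr pair; ring. Qed.

Lemma qfixed_real q : qconj q = q -> exists r : R, q = (r%:C%C, 0).
Proof.
case: q => [[a b] [c e]]; rewrite /qconj => -[bE cE eE]; exists a.
by congr pair; apply/eqP; rewrite eq_complex /=; apply/andP; split; apply/eqP;
  lra.
Qed.

(** The quaternion [q = x^* A x] equals its conjugate because [A] is Hermitian, and equals [N lam]
    with [N = |x|^2 > 0] real; hence [lam] equals its conjugate. *)
Lemma qherm_eig_real (I : finType) (A : I -> I -> quat R) lam :
  qherm A -> qeig A lam -> exists r : R, lam = (r%:C%C, 0).
Proof.
move=> Ah [x [[i0 xi0] Ax]].
pose N := \sum_a qnorm2 (x a).
have N0 : 0 < N.
  rewrite lt0r sumr_ge0 => [|a _]; last exact: qnorm2_ge0.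
  rewrite andbT psumr_neq0 => [|a _]; last exact: qnorm2_ge0.
  apply/hasP; exists i0; rewrite ?mem_index_enum//= lt0r qnorm2_ge0 andbT.
  by apply: contra xi0 => /eqP/qnorm2_eq0 ->.
pose q := \sum_a qmul (qconj (x a)) (\sum_b qmul (A a b) (x b)).
have qE : q = qmul (N%:C%C, 0) lam.
  rewrite /q.
  under eq_bigr do rewrite Ax qmulA qconj_mul.
  rewrite -qmul_suml.
  congr qmul; rewrite /N.
  elim: (index_enum I) => [|a s IH]; first by rewrite !big_nil.
  by rewrite !big_cons IH rmorphD/=; congr pair; rewrite addr0.
have qq : qconj q = q.
  rewrite /q (big_morph (@qconj R) qconjD qconj0).
  transitivity (\sum_a \sum_b qmul (qconj (x b)) (qmul (A b a) (x a))).
    apply: eq_bigr => a _; rewrite qconjM qconjK.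
    rewrite (big_morph (@qconj R) qconjD qconj0).
    rewrite qmul_suml.
    by apply: eq_bigr => b _; rewrite qconjM -qmulA -Ah.
  by rewrite exchange_big; apply: eq_bigr => a _ /=; rewrite qmul_sumr.
apply: qfixed_real; move: qq; rewrite qE !qreal_mul /qconj /= rmorphM /=.
have -> : Num.conj (N%:C%C : R[i]) = N%:C%C by exact: conjc_real.
have NC : N%:C%C != 0 by rewrite (inj_eq (@complexI R) N 0) gt_eqF.
move=> -[e1 e2]; rewrite [RHS]surjective_pairing; congr pair.
  exact: (mulfI NC).
by apply: (mulfI NC); rewrite mulrN.
Qed.
End quaternion.

(** * The complex symbol *)

Section symbol.
Variables (R : realType) (d s : nat) (Z W : d.-tuple (RL R) -> 'M[R[i]]_s).
Variable SL : {set 'I_d}.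
Hypothesis ZW : L1 Z W.
Local Notation Tor := (d.-tuple (RL R)).
Local Notation P := (torus_prob R d).
Local Notation G := (Gmat Z W SL).
Implicit Type k : 'I_d -> int.

Lemma cintegrableZ_entry p q : cintegrable (fun t => Z t p q).
Proof. by have [] := ZW p q. Qed.

Lemma cintegrableW_entry p q : cintegrable (fun t => W t p q).
Proof. by have [] := ZW p q. Qed.

Lemma negTE (t : Tor) : negT t = flip (fun=> true) t.
Proof. by []. Qed.

Lemma rSE (t : Tor) : rS SL t = flip (fun j => j \in SL) t.
Proof. by []. Qed.

Lemma rS_negTE (t : Tor) : rS SL (negT t) = flip (fun j => j \notin SL) t.
Proof.
apply: eq_from_tnth => j; rewrite !tnth_mktuple /flip1.
by case: (j \in SL); rewrite //= opprK.
Qed.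

Lemma dot_negT k (t : Tor) : dot k (negT t) = - dot k t.
Proof.
by rewrite /dot -sumrN; apply: eq_bigr => j _; rewrite tnth_mktuple mulrN.
Qed.

Lemma rSK (t : Tor) : rS SL (rS SL t) = t.
Proof.
apply: eq_from_tnth => j; rewrite !tnth_mktuple.
by case: (j \in SL) => //; rewrite opprK.
Qed.

Lemma dotS_setC k (t : Tor) : dotS SL k t + dotS (~: SL)%SET k t = dot k t.
Proof.
rewrite /dotS /dot [RHS](bigID (mem SL))/=; congr (_ + _).
by apply: eq_bigl => j; rewrite inE.
Qed.

Lemma dotS_rS k (t : Tor) : - dotS SL k t + dotS (~: SL)%SET k t =
  dot k (rS SL t).
Proof.
rewrite /dotS /dot [RHS](bigID (mem SL))/= -sumrN; congr (_ + _).
  by apply: eq_bigr => j jS; rewrite tnth_mktuple jS mulrN.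
apply: eq_big => [j|j]; first by rewrite inE.
by rewrite inE => /negbTE jS; rewrite tnth_mktuple jS.
Qed.

(** Ordinary Fourier coefficients of the symbol. The lemmas [Ghat_ul] to [Ghat_dr] identify them
    with the complex representation [[[a, b], [- conj b, conj a]]] of the sandwich coefficient
    [a + b j]. *)
Definition Ghat k (a b : 'I_(s + s)) : R[i] :=
  cint (fun t => G t a b * expi (- dot k t)).

Lemma cintegrableG a b : cintegrable (fun t => G t a b).
Proof.
case: (split_ordP a) => p ->; case: (split_ordP b) => q ->.
- by apply: eq_cintegrable (cintegrableZ_entry p q) => t; rewrite block_mxEul.
- apply: eq_cintegrable (cintegrable_flip (fun j => j \notin SL)
    (cintegrableW_entry p q)) => t.
  by rewrite block_mxEur rS_negTE.
- apply: eq_cintegrable (cintegrableZ (-1) (cintegrable_conj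
    (cintegrable_flip (fun j => j \in SL) (cintegrableW_entry p q)))) => t.
  by rewrite block_mxEdl !mxE mulN1r -rSE.
- apply: eq_cintegrable (cintegrable_conj
    (cintegrable_flip (fun=> true) (cintegrableZ_entry p q))) => t.
  by rewrite block_mxEdr !mxE -negTE.
Qed.

Lemma cintegrableN_expi k (g : Tor -> R[i]) :
  cintegrable g -> cintegrable (fun t => g t * expi (- dot k t)).
Proof.
move=> gi; apply: eq_cintegrable (cintegrable_expi (fun j => - k j) gi) => t.
by rewrite dotN.
Qed.

(** Since [j e = conj e j], the right exponential reaches [w] conjugated; the [W] part thus sees the
    frequency [k] at the reflected point [rS SL t]. *)
Lemma qmul_sandwich (e1 e2 z w : R[i]) :
  qmul (qmul (qC e1) (z, w)) (qC e2) = (z * (e1 * e2), w * (e1 * conjc e2)).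
Proof.
rewrite /qmul /qC /=; congr pair; first by ring.
by rewrite mulr0 add0r mul0r addr0 mulrCA mulrA.
Qed.

Lemma fhat1E k p q : (fhat Z W SL k p q).1 =
  cint (fun t => Z t p q * expi (- dot k t)).
Proof.
by apply: eq_cint => t; rewrite qmul_sandwich /= -expiD -opprD dotS_setC.
Qed.

Lemma fhat2E k p q : (fhat Z W SL k p q).2 =
  cint (fun t => W t p q * expi (dot k (rS SL t))).
Proof.
by apply: eq_cint => t; rewrite qmul_sandwich -dotS_rS expiD conjc_expi opprK.
Qed.

Lemma Ghat_ul k p q : Ghat k (lshift s p) (lshift s q) = (fhat Z W SL k p q).1.
Proof. by rewrite fhat1E; apply: eq_cint => t; rewrite block_mxEul. Qed.

Lemma cintegrableW_rS k p q :
  cintegrable (fun t => W t p q * expi (dot k (rS SL t))).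
Proof.
apply: eq_cintegrable (cintegrable_flip (fun j => j \in SL) (cintegrable_expi k
  (cintegrable_flip (fun j => j \in SL) (cintegrableW_entry p q)))) => t.
by rewrite -!rSE rSK.
Qed.

(** Reflecting the coordinates outside [SL] sends [rS SL t] to [- t], which restores the ordinary
    exponential. *)
Lemma Ghat_ur k p q : Ghat k (lshift s p) (rshift s q) = (fhat Z W SL k p q).2.
Proof.
have i := cintegrableW_rS k p q.
rewrite fhat2E -(cint_flip (fun j => j \notin SL) i); apply: eq_cint => t.
by rewrite block_mxEur -rS_negTE rSK dot_negT.
Qed.

Lemma Ghat_dl k p q : Ghat k (rshift s p) (lshift s q) =
  - conjc (fhat Z W SL k p q).2.
Proof.
have i := cintegrableW_rS k p q.
rewrite fhat2E -(cint_flip (fun j => j \in SL) i) -mulN1r.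
have i' := cintegrable_flip (fun j => j \in SL) i.
rewrite -cint_conj// -cintZ; last exact: cintegrable_conj i'.
apply: eq_cint => t; rewrite block_mxEdl !mxE -rSE rSK.
by rewrite conjcM conjc_expi mulN1r mulNr.
Qed.

Lemma Ghat_dr k p q : Ghat k (rshift s p) (rshift s q) =
  conjc (fhat Z W SL k p q).1.
Proof.
have i := cintegrableN_expi k (cintegrableZ_entry p q).
rewrite fhat1E -(cint_flip (fun=> true) i) -cint_conj;
  last exact: cintegrable_flip i.
apply: eq_cint => t; rewrite block_mxEdr !mxE -negTE dot_negT opprK.
by rewrite conjcM conjc_expi.
Qed.

Hypothesis Therm : forall n : 'I_d -> nat, qherm (toep Z W SL n).

(** Every [k] is a difference of two indices of a large enough box: [al] is its positive part, [be]
    its negative part, and side [|k_j| + 1] holds both. Hermitian symmetry of that one matrix gives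
    the claim. *)
Lemma fhat_herm k p q :
  fhat Z W SL (fun j => - k j) q p = qconj (fhat Z W SL k p q).
Proof.
pose n j := (`|k j|%N).+1.
pose al : Lam n := [ffun j => if 0 <= k j then inord `|k j|%N else ord0].
pose be : Lam n := [ffun j => if 0 <= k j then ord0 else inord `|k j|%N].
have kE : (fun l => (al l : nat)%:Z - (be l : nat)%:Z) = k.
  apply/funext => j; rewrite !ffunE.
  by case: (lerP 0 (k j)) => kj; rewrite /= inordK//; lia.
have kNE : (fun l => (be l : nat)%:Z - (al l : nat)%:Z) = (fun j => - k j).
  by apply/funext => j; rewrite -kE opprB.
have abE : toep Z W SL n (al, p) (be, q) = fhat Z W SL k p q.
  exact: (congr1 (fun k => fhat Z W SL k p q) kE).
have baE : toep Z W SL n (be, q) (al, p) = fhat Z W SL (fun j => - k j) q p.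
  exact: (congr1 (fun k => fhat Z W SL k q p) kNE).
by rewrite -abE -baE; exact: Therm.
Qed.

Lemma Ghat_herm k a b : Ghat (fun j => - k j) b a = conjc (Ghat k a b).
Proof.
case: (split_ordP a) => p ->; case: (split_ordP b) => q ->;
  rewrite ?(Ghat_ul, Ghat_ur, Ghat_dl, Ghat_dr) fhat_herm;
  case: (fhat Z W SL k p q) => z w; rewrite /qconj /=.
- by [].
- by rewrite rmorphN opprK.
- by rewrite rmorphN /= conjcK.
- by [].
Qed.

Lemma G_herm_ae : {ae P, forall t, forall a b, G t b a = conjc (G t a b)}.
Proof.
have H a b : {ae P, forall t, G t b a = conjc (G t a b)}.
  have i : cintegrable (fun t => G t b a + (-1) * conjc (G t a b)).
    by apply: cintegrableD; [|apply/cintegrableZ/cintegrable_conj];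
      exact: cintegrableG.
  suff h : {ae P, forall t, G t b a + (-1) * conjc (G t a b) = 0}.
    by apply: filterS h => t /eqP; rewrite mulN1r subr_eq0 => /eqP.
  apply: cint_fourier_uniqueness => // k.
  have i1 := cintegrable_expi k (cintegrableG b a).
  have i2 := cintegrable_conj (cintegrableN_expi k (cintegrableG a b)).
  (* Conjugation turns [e^(-i<k,t>)] into [e^(i<k,t>)], so the coefficient of the difference is
     exactly the defect in [Ghat_herm]. *)
  transitivity (Ghat (fun j => - k j) b a + (-1) * conjc (Ghat k a b)).
    rewrite /Ghat -cint_conj; last exact: cintegrableN_expi (cintegrableG a b).
    rewrite -cintZ// -cintD; last 2 first.
    - by apply: eq_cintegrable i1 => t; rewrite dotN opprK.
    - exact: cintegrableZ.
    apply: eq_cint => t; rewrite dotN opprK mulrDl conjcM conjc_expi opprK.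
    by rewrite mulrA.
  by rewrite Ghat_herm mulN1r subrr.
have H2 a : {ae P, forall t, forall b, G t b a = conjc (G t a b)}.
  exact: filter_forall.
exact: filter_forall.
Qed.

(** * The quadratic form of the symbol on an eigenvector *)

Section eigenvector.
Variables (n : 'I_d -> nat) (x : (Lam n * 'I_s)%type -> quat R) (r : R).
Hypothesis Tx : forall a, \sum_b qmul (toep Z W SL n a b) (x b) =
  qmul (x a) ((r%:C)%C, 0).

Definition idx (al : Lam n) : 'I_d -> int := fun l => (al l : nat)%:Z.
Definition idxB (al be : Lam n) : 'I_d -> int :=
  fun l => (al l : nat)%:Z - (be l : nat)%:Z.

(** The first column of the complex representation of [x]. The representation is multiplicative, so
    first columns of [T x = x r] give a complex eigenvector equation. *)
Definition cvec (al : Lam n) (i : 'I_(s + s)) : R[i] :=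
  match fintype.split i with
  | inl p => (x (al, p)).1
  | inr p => - conjc (x (al, p)).2
  end.

Lemma cvec_l al p : cvec al (lshift s p) = (x (al, p)).1.
Proof. by rewrite /cvec (unsplitK (inl p)). Qed.

Lemma cvec_r al p : cvec al (rshift s p) = - conjc (x (al, p)).2.
Proof. by rewrite /cvec (unsplitK (inr p)). Qed.

Lemma fst_sum (I : Type) (l : seq I) (F : I -> quat R) :
  (\sum_(i <- l) F i).1 = \sum_(i <- l) (F i).1.
Proof. by apply: (big_morph (fun q : quat R => q.1)). Qed.

Lemma snd_sum (I : Type) (l : seq I) (F : I -> quat R) :
  (\sum_(i <- l) F i).2 = \sum_(i <- l) (F i).2.
Proof. by apply: (big_morph (fun q : quat R => q.2)). Qed.

Lemma cvec_eig al i :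
  \sum_be \sum_j Ghat (idxB al be) i j * cvec be j = (r%:C)%C * cvec al i.
Proof.
have T1 p : \sum_be \sum_q ((fhat Z W SL (idxB al be) p q).1 * (x (be, q)).1
    - (fhat Z W SL (idxB al be) p q).2 * conjc (x (be, q)).2) =
    (r%:C)%C * (x (al, p)).1.
  transitivity (\sum_b (qmul (toep Z W SL n (al, p) b) (x b)).1).
    by rewrite pair_big; apply: eq_bigr => -[be q] _.
  by rewrite -fst_sum Tx /qmul /= rmorph0; ring.
have T2 p : \sum_be \sum_q ((fhat Z W SL (idxB al be) p q).1 * (x (be, q)).2
    + (fhat Z W SL (idxB al be) p q).2 * conjc (x (be, q)).1) =
    (r%:C)%C * (x (al, p)).2.
  transitivity (\sum_b (qmul (toep Z W SL n (al, p) b) (x b)).2).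
    by rewrite pair_big; apply: eq_bigr => -[be q] _.
  rewrite -snd_sum Tx [LHS](_ : _ =
    (x (al, p)).1 * 0 + (x (al, p)).2 * conjc ((r%:C)%C))//.
  by rewrite conjc_real mulr0 add0r mulrC.
case: (split_ordP i) => p ->.
  rewrite cvec_l -T1; apply: eq_bigr => be _;
    rewrite big_split_ord/= -big_split/=.
  by apply: eq_bigr => q _; rewrite Ghat_ul Ghat_ur cvec_l cvec_r mulrN.
(* The lower half is minus the conjugate of the [j] component, and [r] is unchanged because it is
   real. *)
rewrite cvec_r mulrN -[(r%:C)%C]conjc_real -conjcM -T2 conjc_sum -sumrN.
apply: eq_bigr => be _; rewrite big_split_ord/= -big_split/= conjc_sum -sumrN.
apply: eq_bigr => q _; rewrite Ghat_dl Ghat_dr cvec_l cvec_r.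
by rewrite conjcD !conjcM conjcK opprD addrC mulrN mulNr.
Qed.

(* The entries of [v(t)^*], as a row vector. *)
Definition trigvec (t : Tor) : 'rV[R[i]]_(s + s) :=
  \row_i \sum_al conjc (cvec al i) * expi (- dot (idx al) t).

Lemma trigvecE t i : trigvec t 0 i =
  \sum_al conjc (cvec al i) * expi (- dot (idx al) t).
Proof. by rewrite mxE. Qed.

Lemma conjc_trigvec t i :
  conjc (trigvec t 0 i) = \sum_al cvec al i * expi (dot (idx al) t).
Proof.
rewrite trigvecE conjc_sum; apply: eq_bigr => al _.
by rewrite conjcM conjcK conjc_expi opprK.
Qed.

Lemma expi_idxB al be (t : Tor) :
  expi (- dot (idxB al be) t) = expi (- dot (idx al) t) * expi (dot (idx be) t).
Proof.
have -> : dot (idxB al be) t = dot (idx al) t - dot (idx be) t.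
  by rewrite /dot -sumrB; apply: eq_bigr => j _; rewrite /idxB intrB mulrBl.
by rewrite opprB addrC expiD.
Qed.

Definition cnorm2 : R[i] := \sum_al \sum_i conjc (cvec al i) * cvec al i.

Lemma trigvec_formE t :
  \sum_i \sum_j trigvec t 0 i * G t i j * conjc (trigvec t 0 j) =
  \sum_al \sum_i \sum_be \sum_j
    (conjc (cvec al i) * cvec be j) * (G t i j * expi (- dot (idxB al be) t)).
Proof.
rewrite [RHS]exchange_big; apply: eq_bigr => i _ /=.
transitivity (\sum_j \sum_al \sum_be
    (conjc (cvec al i) * cvec be j) * (G t i j * expi (- dot (idxB al be) t))).
  apply: eq_bigr => j _; rewrite trigvecE conjc_trigvec !mulr_suml.
  apply: eq_bigr => al _; rewrite mulr_sumr; apply: eq_bigr => be _.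
  by rewrite expi_idxB; ring.
by rewrite exchange_big; apply: eq_bigr => al _ /=; rewrite exchange_big.
Qed.

Lemma cintegrable_form : cintegrable (fun t =>
  \sum_i \sum_j trigvec t 0 i * G t i j * conjc (trigvec t 0 j)).
Proof.
apply: (@eq_cintegrable _ _ _ _ (fun t => esym (trigvec_formE t))).
by do 4 apply: cintegrable_sum => ?; apply: cintegrableZ;
  apply: cintegrableN_expi; exact: cintegrableG.
Qed.

(** Integrating the expanded form term by term produces the entries of [Ghat], to which the
    eigenvector equation [cvec_eig] applies. *)
Lemma cint_form : cint (fun t =>
  \sum_i \sum_j trigvec t 0 i * G t i j * conjc (trigvec t 0 j)) =
    (r%:C)%C * cnorm2.
Proof.
rewrite (eq_cint trigvec_formE).
have i4 al i be j : cintegrable (fun t =>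
    (conjc (cvec al i) * cvec be j) * (G t i j * expi (- dot (idxB al be) t))).
  by apply: cintegrableZ; apply: cintegrableN_expi; exact: cintegrableG.
have i3 al i be := cintegrable_sum (index_enum _) (i4 al i be).
have i2 al i := cintegrable_sum (index_enum _) (i3 al i).
have i1 al := cintegrable_sum (index_enum _) (i2 al).
rewrite cint_sum//= mulr_sumr; apply: eq_bigr => al _.
rewrite cint_sum//= mulr_sumr; apply: eq_bigr => i _.
rewrite cint_sum//= mulrCA -cvec_eig mulr_sumr; apply: eq_bigr => be _.
rewrite cint_sum//= mulr_sumr; apply: eq_bigr => j _.
rewrite cintZ; last by apply: cintegrableN_expi; exact: cintegrableG.
by rewrite -/(Ghat (idxB al be) i j) mulrAC mulrA.
Qed.

Lemma trigvec_normE t : \sum_i trigvec t 0 i * conjc (trigvec t 0 i) =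
  \sum_al \sum_i \sum_be
    (conjc (cvec al i) * cvec be i) * (1 * expi (- dot (idxB al be) t)).
Proof.
rewrite [RHS]exchange_big; apply: eq_bigr => i _ /=.
rewrite conjc_trigvec trigvecE mulr_suml.
apply: eq_bigr => al _; rewrite mulr_sumr; apply: eq_bigr => be _.
by rewrite expi_idxB; ring.
Qed.

Lemma cintegrable_norm :
  cintegrable (fun t => \sum_i trigvec t 0 i * conjc (trigvec t 0 i)).
Proof.
apply: (@eq_cintegrable _ _ _ _ (fun t => esym (trigvec_normE t))).
by do 3 apply: cintegrable_sum => ?; apply: cintegrableZ;
  apply: cintegrableN_expi; exact: cintegrable1.
Qed.

Lemma cint_norm :
  cint (fun t => \sum_i trigvec t 0 i * conjc (trigvec t 0 i)) = cnorm2.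
Proof.
rewrite (eq_cint trigvec_normE).
have i3 al i be : cintegrable (fun t =>
    (conjc (cvec al i) * cvec be i) * (1 * expi (- dot (idxB al be) t))).
  by apply: cintegrableZ; apply: cintegrableN_expi; exact: cintegrable1.
have i2 al i := cintegrable_sum (index_enum _) (i3 al i).
have i1 al := cintegrable_sum (index_enum _) (i2 al).
rewrite cint_sum//=; apply: eq_bigr => al _.
rewrite cint_sum//=; apply: eq_bigr => i _.
(* Orthogonality of the exponentials: only [be = al] survives, which is Parseval's identity for
   [trigvec]. *)
have E be : cint (fun t =>
      (conjc (cvec al i) * cvec be i) * (1 * expi (- dot (idxB al be) t))) =
    (conjc (cvec al i) * cvec be i) * (be == al)%:R.
  rewrite cintZ; last by apply: cintegrableN_expi; exact: cintegrable1.
  congr (_ * _); transitivity (cint (fun t : Tor => expi (dot (idxB be al) t))).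
    apply: eq_cint => t; rewrite mul1r -dotN; congr (expi (dot _ _)).
    by apply/funext => l; rewrite /idxB opprB.
  rewrite cint_expi; congr (_%:R); congr nat_of_bool;
    apply/forallP/eqP => [h|-> l].
    apply/ffunP => l; apply/val_inj/eqP; have := h l.
    by rewrite /idxB subr_eq0.
  by rewrite /idxB subrr.
rewrite cint_sum//=.
under eq_bigr do rewrite E.
rewrite (bigD1 al)//= eqxx mulr1 big1 ?addr0// => be /negbTE ->.
by rewrite mulr0.
Qed.

Lemma cnorm2_gt0 : (exists i, x i != 0) -> 0 < complex.Re cnorm2.
Proof.
move=> [[al p] xi].
have p0 (z : R[i]) : 0 <= complex.Re (conjc z * z).
  by have := mulcJ_ge0 z; rewrite lecE mulrC => /andP[].
have p1 (z : R[i]) : z != 0 -> 0 < complex.Re (conjc z * z).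
  move=> z0; have : 0 < conjc z * z.
    by rewrite lt0r mulrC mulcJ_ge0 mulf_neq0// conjc_eq0.
  by rewrite ltcE => /andP[].
have [i yi] : exists i, cvec al i != 0.
  have [x1|x1] := eqVneq (x (al, p)).1 0.
    exists (rshift s p); rewrite cvec_r oppr_eq0 conjc_eq0.
    apply: contra xi => /eqP x2; apply/eqP.
    by rewrite [LHS]surjective_pairing x1 x2.
  by exists (lshift s p); rewrite cvec_l.
rewrite /cnorm2 cRe_sum (bigD1 al)//= ltr_pwDl//.
  rewrite cRe_sum (bigD1 i)//= ltr_pwDl//; first exact: p1.
  by apply: sumr_ge0 => j _.
by apply: sumr_ge0 => be _; rewrite cRe_sum sumr_ge0.
Qed.

Lemma trigvec_norm_ge0 t :
  0 <= complex.Re (\sum_i trigvec t 0 i * conjc (trigvec t 0 i)).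
Proof.
rewrite cRe_sum sumr_ge0// => i _.
by have := mulcJ_ge0 (trigvec t 0 i); rewrite lecE => /andP[].
Qed.

Lemma Rintegral_form :
  \int[P]_t complex.Re
    (\sum_i \sum_j trigvec t 0 i * G t i j * conjc (trigvec t 0 j)) =
  r * complex.Re cnorm2.
Proof. by have /(congr1 (@complex.Re R)) := cint_form;
  rewrite cReM /= mul0r subr0. Qed.

Lemma Rintegral_norm :
  \int[P]_t complex.Re (\sum_i trigvec t 0 i * conjc (trigvec t 0 i)) =
    complex.Re cnorm2.
Proof. by have /(congr1 (@complex.Re R)) := cint_norm. Qed.

(** Integrating the a.e. inequality [v^* G v - c |v|^2 >= 0] gives [(r - c) |y|^2 >= 0], with [y]
    nonzero. *)
Lemma eig_ge (c : R) : (exists i, x i != 0) ->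
  {ae P, forall t, c <= lam_min (G t)} -> c <= r.
Proof.
move=> x0 cG; have N0 := cnorm2_gt0 x0.
have [fr _] := cintegrable_form; have [nr _] := cintegrable_norm.
have := Rintegral_ae_ge0 (integrable_lin 1 (- c) fr nr).
rewrite Rintegral_lin// Rintegral_form Rintegral_norm.
rewrite mul1r -mulrDl pmulr_lge0// subr_ge0; apply.
apply: filterS2 cG (G_herm_ae) => t ct Gt.
have /andP[+ _] := rayleigh_bounds Gt (trigvec t).
have := ler_wpM2r (trigvec_norm_ge0 t) ct; lra.
Qed.

Lemma eig_le (c : R) : (exists i, x i != 0) ->
  {ae P, forall t, lam_max (G t) <= c} -> r <= c.
Proof.
move=> x0 cG; have N0 := cnorm2_gt0 x0.
have [fr _] := cintegrable_form; have [nr _] := cintegrable_norm.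
have := Rintegral_ae_ge0 (integrable_lin (-1) c fr nr).
rewrite Rintegral_lin// Rintegral_form Rintegral_norm.
rewrite mulN1r -mulNr -mulrDl pmulr_lge0// addrC subr_ge0; apply.
apply: filterS2 cG (G_herm_ae) => t ct Gt.
have /andP[_ +] := rayleigh_bounds Gt (trigvec t).
have := ler_wpM2r (trigvec_norm_ge0 t) ct; lra.
Qed.
End eigenvector.
End symbol.

Theorem mainTheorem14 (R : realType) (d s : nat)
    (Z W : d.-tuple (RL R) -> 'M[R[i]]_s) (SL : {set 'I_d}) :
  L1 Z W ->
  (forall n : 'I_d -> nat, qherm (toep Z W SL n)) ->
  forall (n : 'I_d -> nat) (lam : quat R),
    qeig (toep Z W SL n) lam ->
    exists r : R, lam = ((r%:C)%C, 0) /\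
      (m_tau Z W SL <= r%:E <= M_tau Z W SL)%E.
Proof.
move=> ZW Th n lam lamE; have [r rE] := qherm_eig_real (Th n) lamE.
exists r; split => //; move: lamE; rewrite rE => -[x [x0 Tx]].
(* Excludes an essential infimum [+oo] or supremum [-oo]: a real-valued function would have to be
   infinite a.e. on a space of mass 1. *)
have nF : ~ {ae torus_prob R d, forall t, False}.
  move=> [N [mN N0 FN]].
  have NT : N = setT by apply/seteqP; split => // t _; exact: FN.
  have := probability_setT (torus_prob R d); rewrite -NT N0 => /eqP.
  by rewrite eq_sym onee_eq0.
have mle := ess_inf_le (torus_prob R d) (fun t => (lam_min (Gmat Z W SL t))%:E).
have Mge := ess_sup_ge (torus_prob R d) (fun t => (lam_max (Gmat Z W SL t))%:E).
apply/andP; split.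
(* A finite bound is the constant fed to [eig_ge]; the value [-oo] bounds trivially. *)
- rewrite /m_tau; case: ess_inf mle => [c| |] // => cG.
  + by rewrite lee_fin; apply: (eig_ge ZW Th Tx x0); apply: filterS cG => t;
      rewrite lee_fin.
  + by exfalso; apply: nF; apply: filterS cG => t.
  + exact: leNye.
- rewrite /M_tau; case: ess_sup Mge => [c| |] // => cG.
  + by rewrite lee_fin; apply: (eig_le ZW Th Tx x0); apply: filterS cG => t;
      rewrite lee_fin.
  + by rewrite leey.
  + by exfalso; apply: nF; apply: filterS cG => t.
Qed.
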